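(* Fix $\sigma>0$ and $d\ge1$ (and $K>0$). For any $n$, $$\sup_{P\in\mathcal{F}^{(\mathsf{SG})}_{d,K}}\mathbb{E}_{P^{\otimes n}}\big|h(P\ast\mathcal{N}_\sigma)-h(\hat P_{S^n}\ast\mathcal{N}_\sigma)\big|\le C_{\sigma,d,K}\,\frac1{\sqrt n},$$ where $C_{\sigma,d,K}=O_{\sigma,K}(c^d)$, for a numerical constant $c$, is given explicitly by $$C_{\sigma,d,K}=\left[\frac{64\Big(2d^2K^4+d(d+2)\big(K+\sigma/\sqrt2\big)^4\Big)}{\sigma^4}\left(\Big(\frac1{\sqrt2}+\frac K\sigma\Big)e^{\frac38}\right)^d\right]^{1/2}.$$
   Context: A distribution $P$ on $\mathbb{R}^d$ is $K$-subgaussian, for $K>0$, if $X\sim P$ satisfies $\mathbb{E}\big[\exp(\alpha^T(X-\mathbb{E}X))\big]\le \exp\big(\tfrac12K^2\|\alpha\|^2\big)$ for all $\alpha\in\mathbb{R}^d$; $\mathcal{F}^{(\mathsf{SG})}_{d,K}$ is the class of all $K$-subgaussian distributions on $\mathbb{R}^d$. $\mathcal{N}_\sigma=\mathcal{N}(0,\sigma^2\mathrm{I}_d)$ is the isotropic Gaussian measure; $S^n=(S_1,\dots,S_n)\sim P^{\otimes n}$ are $n$ i.i.d. samples from $P$; $\hat P_{S^n}=\frac1n\sum_{i=1}^n\delta_{S_i}$ is the empirical measure, with $\delta_x$ the Dirac measure at $x$; $\ast$ is convolution of measures; $h(\cdot)$ is differential entropy with natural logarithm. $O_{\sigma,K}(\cdot)$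 means that the implied constant may depend on $\sigma$ and $K$.
   Formalization: The constant c in C = O(c^d) may depend on σ and K (not on d or n): with c an absolute numerical constant the claim contradicts the explicit formula, since C^(1/d) tends to sqrt((1/√2+K/σ)e^{3/8}), which is unbounded in K/σ. *)

(* Defs.v *)
From HB Require Import structures.
From mathcomp Require Import all_boot all_order all_algebra.
From mathcomp Require Import all_classical all_reals all_analysis.
Set Implicit Arguments.
Unset Strict Implicit.
Unset Printing Implicit Defensive.
Import Order.TTheory GRing.Theory Num.Theory.
Import numFieldNormedType.Exports.
Local Open Scope classical_set_scope.
Local Open Scope ring_scope.
Local Open Scope ereal_scope.
Local Open Scope charge_scope.

Definition cons_pair (T : Type) (n : nat) (p : T * n.-tuple T) : n.+1.-tuple T :=
  [the n.+1.-tuple T of p.1 :: p.2].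

Lemma measurable_cons_pair d (T : measurableType d) (n : nat) :
  measurable_fun [set: T * n.-tuple T] (@cons_pair T n).
Proof. exact: measurable_cons. Qed.

Lemma product_sigma_finite d1 d2 (T1 : measurableType d1)
    (T2 : measurableType d2) (R : realType)
    (m1 : {sigma_finite_measure set T1 -> \bar R})
    (m2 : {sigma_finite_measure set T2 -> \bar R}) :
  sigma_finite setT (m1 \x m2).
Proof.
have /sigma_finiteP[F [TF ndF Foo]] := sigma_finiteT m1.
have /sigma_finiteP[G [TG ndG Goo]] := sigma_finiteT m2.
exists (fun n => F n `*` G n).
  rewrite -setXTT TF TG predeqE => -[x y]; split=> [[[n _ Fnx] [k _ Gky]]|].
    exists (maxn n k) => //; split.
    - by have /subsetPset := ndF _ _ (leq_maxl n k); exact.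
    - by have /subsetPset := ndG _ _ (leq_maxr n k); exact.
  by move=> [n _ []/= ? ?]; split; exists n.
move=> k; have [? ?] := Foo k; have [? ?] := Goo k.
split; first exact: measurableX.
by rewrite product_measure1E// lte_mul_pinfty// ge0_fin_numE.
Qed.

Section product_pow.
Context d (T : measurableType d) (R : realType) (mu : set T -> \bar R).

(* n-fold product measure on [n.-tuple T], split along T^(n+1) = T * T^n. *)
Fixpoint product_pow (n : nat) : set (n.-tuple T) -> \bar R :=
  match n with
  | 0 => @dirac _ (0.-tuple T) [tuple] R
  | n'.+1 => pushforward (mu \x @product_pow n') (@cons_pair T n')
  end.
End product_pow.
Arguments product_pow {d T R} mu n _.

Section product_pow_sigma_finite.
Context d (T : measurableType d) (R : realType).
Variable mu : {sigma_finite_measure set T -> \bar R}.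

Section step.
Variables (n : nat) (nu : {sigma_finite_measure set (n.-tuple T) -> \bar R}).
Let m := pushforward (mu \x nu) (@cons_pair T n).

Let m0 : m set0 = 0.
Proof. by rewrite /m /pushforward preimage_set0 measure0. Qed.

Let m_ge0 A : 0 <= m A.
Proof. by rewrite /m /pushforward measure_ge0. Qed.

Let m_sigma_additive : semi_sigma_additive m.
Proof.
have mc := @measurable_cons_pair _ T n.
apply: measure_semi_sigma_additive; exact: mc.
Qed.

HB.instance Definition _ := isMeasure.Build _ _ _ m m0 m_ge0 m_sigma_additive.

Let m_sigma_finite : sigma_finite setT m.
Proof.
have [F TF Foo] := product_sigma_finite mu nu.
pose u := fun t : n.+1.-tuple T => (thead t, [tuple of behead t]).
have uK t : cons_pair (u t) = t by rewrite [RHS]tuple_eta; apply: val_inj.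
have cK p : u (cons_pair p) = p.
  by case: p => x t; rewrite /u theadE; congr pair; apply: val_inj.
exists (fun k => u @^-1` F k).
  by rewrite -preimage_bigcup -TF.
move=> k; have [mF Fk] := Foo k; split.
  rewrite -[X in measurable X]setTI.
  apply: (@measurable_fun_pair _ _ _ _ _ _ _ _ _ _) => //.
    exact: measurable_tnth.
  exact: measurable_behead.
rewrite /m /pushforward (_ : _ @^-1` _ = F k)//.
by apply/seteqP; split=> p /=; rewrite cK.
Qed.

HB.instance Definition _ := Measure_isSigmaFinite.Build _ _ _ m m_sigma_finite.

Lemma product_pow_step :
  exists nu' : {sigma_finite_measure set (n.+1.-tuple T) -> \bar R},
    pushforward (mu \x nu) (@cons_pair T n) = nu'.
Proof. by exists m. Qed.

End step.

Let product_powP n :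
  exists nu : {sigma_finite_measure set (n.-tuple T) -> \bar R},
    product_pow mu n = nu.
Proof.
elim: n => [|n [nu IH]] /=; first by exists (@dirac _ (0.-tuple T) [tuple] R).
by rewrite IH; exact: product_pow_step.
Qed.

Variable n : nat.
Let pow := product_pow mu n.

Let pow0 : pow set0 = 0.
Proof. by rewrite /pow; have [nu ->] := product_powP n; exact: measure0. Qed.

Let pow_ge0 A : 0 <= pow A.
Proof. by rewrite /pow; have [nu ->] := product_powP n; exact: measure_ge0. Qed.

Let pow_sigma_additive : semi_sigma_additive pow.
Proof.
rewrite /pow; have [nu ->] := product_powP n.
exact: measure_semi_sigma_additive.
Qed.

HB.instance Definition _ :=
  isMeasure.Build _ _ _ (product_pow mu n) pow0 pow_ge0 pow_sigma_additive.

Let pow_sigma_finite : sigma_finite setT pow.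
Proof. by rewrite /pow; have [nu ->] := product_powP n; exact: sigma_finiteT. Qed.

HB.instance Definition _ :=
  Measure_isSigmaFinite.Build _ _ _ (product_pow mu n) pow_sigma_finite.

End product_pow_sigma_finite.

Section product_pow_probability.
Context d (T : measurableType d) (R : realType) (P : probability T R) (n : nat).

Let product_pow_setT : product_pow P n [set: n.-tuple T] = 1.
Proof.
elim: n => [|k IH]; first by rewrite /= diracT.
rewrite /= /pushforward preimage_setT -setXTT.
rewrite product_measure1E// -[RHS]mule1 -{1}(probability_setT P).
by congr (_ * _); exact: IH.
Qed.

HB.instance Definition _ :=
  Measure_isProbability.Build _ _ _ (product_pow P n) product_pow_setT.

End product_pow_probability.

Notation rvec R d := (d.-tuple (measurableTypeR R)).

Section euclidean_space.
Context (R : realType) (d : nat).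
Implicit Types (x y : rvec R d) (mu nu : set (rvec R d) -> \bar R).

Definition dotp x y : R := (\sum_(i < d) tnth x i * tnth y i)%R.
Definition addv x y : rvec R d := [tuple (tnth x i + tnth y i)%R | i < d].
Definition subv x y : rvec R d := [tuple (tnth x i - tnth y i)%R | i < d].

Lemma measurable_addv :
  measurable_fun [set: rvec R d * rvec R d] (fun p => addv p.1 p.2).
Proof.
apply/measurable_fun_tnthP => i.
rewrite (_ : _ \o _ = (fun p : rvec R d * rvec R d =>
    (tnth p.1 i : R) + (tnth p.2 i : R))%R); last first.
  by apply/funext => p /=; rewrite tnth_mktuple.
by apply: measurable_realfun.measurable_funD; apply: (measurableT_comp (measurable_tnth i)).
Qed.

Definition lebesgue_pow : set (rvec R d) -> \bar R :=
  product_pow (@lebesgue_measure R) d.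

HB.instance Definition _ := SigmaFiniteMeasure.on lebesgue_pow.

(* N(0, sigma^2 I_d): [normal_prob] takes the standard deviation. *)
Definition gaussian (sigma : R) : set (rvec R d) -> \bar R :=
  product_pow (normal_prob 0%R sigma) d.

HB.instance Definition _ sigma := Probability.on (gaussian sigma).

Definition convolution mu nu : set (rvec R d) -> \bar R :=
  pushforward (mu \x nu) (fun p => addv p.1 p.2).

End euclidean_space.
Arguments lebesgue_pow R d _ : clear implicits.
Arguments gaussian {R} d sigma _.

Section convolution_finite.
Context (R : realType) (d : nat).
Variables mu nu : {finite_measure set (rvec R d) -> \bar R}.
Let conv := convolution mu nu.

Let conv0 : conv set0 = 0.
Proof. by rewrite /conv /convolution /pushforward preimage_set0 measure0. Qed.

Let conv_ge0 A : 0 <= conv A.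
Proof. by rewrite /conv /convolution /pushforward measure_ge0. Qed.

Let conv_sigma_additive : semi_sigma_additive conv.
Proof.
have ma := @measurable_addv R d.
by apply: measure_semi_sigma_additive; exact: ma.
Qed.

HB.instance Definition _ := isMeasure.Build _ _ _ (convolution mu nu)
  conv0 conv_ge0 conv_sigma_additive.

Let conv_fin : fin_num_fun conv.
Proof.
apply: lty_fin_num_fun.
suff : (mu \x nu) (setT `*` setT) < +oo by rewrite setXTT.
rewrite product_measure1E//.
by rewrite lte_mul_pinfty// ?fin_num_measure// -ge0_fin_numE// fin_num_measure.
Qed.

HB.instance Definition _ :=
  Measure_isFinite.Build _ _ _ (convolution mu nu) conv_fin.

End convolution_finite.

Section empirical.
Context (R : realType) (d n : nat) (S : n.-tuple (rvec R d)).

Definition empirical (A : set (rvec R d)) : \bar R :=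
  (n%:R^-1)%:E * \sum_(i < n) \d_(tnth S i) A.

Let empirical0 : empirical set0 = 0.
Proof. by rewrite /empirical big1 ?mule0// => i _; rewrite measure0. Qed.

Let empirical_ge0 A : 0 <= empirical A.
Proof. by rewrite mule_ge0 ?lee_fin ?invr_ge0// sume_ge0. Qed.

Let empirical_sigma_additive : semi_sigma_additive empirical.
Proof.
have n0 : (0 <= n%:R^-1 :> R)%R by rewrite invr_ge0.
pose m k : {measure set (rvec R d) -> \bar R} :=
  @dirac _ (rvec R d) (nth [tuple 0%R | _ < d] S k) R.
rewrite (_ : empirical = mscale (NngNum n0) (msum m n)); last first.
  apply/funext => A; rewrite /empirical /mscale /msum /=; congr (_ * _).
  by apply: eq_bigr => i _; rewrite (tnth_nth [tuple 0%R | _ < d]).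
exact: measure_semi_sigma_additive.
Qed.

HB.instance Definition _ := isMeasure.Build _ _ _ empirical
  empirical0 empirical_ge0 empirical_sigma_additive.

Let empirical_fin : fin_num_fun empirical.
Proof.
move=> A mA; rewrite /empirical fin_numM//.
by apply/sum_fin_numP => i _ _; exact: fin_num_measure.
Qed.

HB.instance Definition _ := Measure_isFinite.Build _ _ _ empirical empirical_fin.

End empirical.

(* h(mu) = - \int f ln f, with f the density of mu for the Lebesgue measure.
   It is only meaningful for mu absolutely continuous, as are all measures
   convolved with a nondegenerate Gaussian.  The Radon-Nikodym derivative is only
   determined almost everywhere, which the integral does not see. *)
Definition differential_entropy (R : realType) (d : nat)
    (mu : {finite_measure set (rvec R d) -> \bar R}) : \bar R :=
  let f x := fine (('d (charge_of_finite_measure mu) '/d (lebesgue_pow R d)) x) in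
  - \int[lebesgue_pow R d]_x (f x * ln (f x))%:E.

Section subgaussian.
Context (R : realType) (d : nat).

Definition mean (P : probability (rvec R d) R) : rvec R d :=
  [tuple (\int[P]_x (tnth x i : R))%R | i < d].

(* [mean] is a total function, hence the explicit integrability clause. *)
Definition subgaussian (K : R) (P : probability (rvec R d) R) : Prop :=
  (forall i : 'I_d, P.-integrable setT (fun x => (tnth x i)%:E)) /\
  forall a : rvec R d,
    \int[P]_x (expR (dotp a (subv x (mean P))))%:E
      <= (expR (2^-1 * K ^+ 2 * dotp a a))%:E.

End subgaussian.

Definition entropy_const (R : realType) (sigma : R) (d : nat) (K : R) : R :=
  Num.sqrt
    (64 * (2 * d%:R ^+ 2 * K ^+ 4
           + d%:R * (d%:R + 2) * (K + sigma / Num.sqrt 2) ^+ 4) / sigma ^+ 4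
     * (((Num.sqrt 2)^-1 + K / sigma) * expR (3 / 8)) ^+ d)%R.

(* Main.v *)
Require Import Defs.
From HB Require Import structures.
From mathcomp Require Import all_boot all_order all_algebra.
From mathcomp Require Import all_classical all_reals all_analysis.
From mathcomp Require Import measurable_realfun ring lra.

(* Write q and r_S for the Lebesgue densities of P * N_sigma and of the smoothed
   empirical measure, both bounded by the peak c = (2 pi sigma^2)^(-d/2).  For
   a, b in ]0, c], |a ln (a/c) - b ln (b/c)| <= |a - b| max(1, - ln (a/c)), so the
   entropies differ by at most the integral of |q - r_S| w, where
   w = max(1, - ln (q/c)) is deterministic and, by Jensen's inequality, grows at
   most quadratically.  Let f be the density of N(E P, 2 (K + sigma/sqrt 2)^2).  By
   Cauchy-Schwarz the expected integral is at most the square root of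
   (E int |q - r_S|^2 / f) (int f w^2).  The variance of an empirical mean bounds the
   first factor by 1/n times the integral over P(dy) dx of
   phi_sigma(x - y)^2 / f(x), which is an exponential moment of |y - E P|^2; the
   second factor only involves fourth moments. *)

Set Implicit Arguments.
Unset Strict Implicit.
Unset Printing Implicit Defensive.
Import Order.TTheory GRing.Theory Num.Theory.
Import numFieldNormedType.Exports.
Local Open Scope classical_set_scope.
Local Open Scope ring_scope.
Local Open Scope ereal_scope.

(* [addv] also names an operation of mathcomp's vector library. *)
Local Notation addv := Defs.addv.
Local Notation subv := Defs.subv.

(** The obstacle is that [u ln u] is not Lipschitz at 0, while the empirical density is random and
    can be far smaller than q. Dividing by c puts both densities in ]0, 1], where only the larger of
    the two governs the logarithm. A lower bound for q alone therefore suffices, and the randomness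
    enters only through |q - r_S|. The variance of f is a compromise. It must be large enough for
    phi_sigma^2 / f to be integrable and for the resulting exponential moment of |y - E P|^2 to be
    finite under the subgaussian hypothesis, yet small enough for the base of the d-th power to stay
    as stated. With t = sigma / sqrt 2 and variance 2 (K + t)^2, each dimension contributes at most
    sqrt 2 (K + t) / sigma, and sqrt 2 is then replaced by e^(3/8). The factor d (d + 2) (K + t)^4
    is the exact fourth moment of the norm of a Gaussian vector of variance (K + t)^2 per
    coordinate. Cruder coordinatewise moments are used here, and the factor 64 leaves room for
    them. *)

(** * Integrals against densities and product measures *)

Lemma ge0_le_integral_nomeas d (T : measurableType d) (R : realType)
    (mu : {measure set T -> \bar R}) (f g : T -> \bar R) :
  (forall x, 0 <= f x) -> (forall x, f x <= g x) ->
  \int[mu]_x f x <= \int[mu]_x g x.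
Proof.
move=> f0 fg; have g0 x : 0 <= g x by exact: le_trans (fg x).
rewrite !ge0_integralTE//; apply: ereal_sup_le => _ [h hf <-].
by exists h => // x; exact: le_trans (hf x) (fg x).
Qed.

(** The change of variables holds for the Radon-Nikodym derivative, and [p] agrees with it almost
    everywhere because both have the same integral over every measurable set. *)
Lemma ge0_integral_density d (T : measurableType d) (R : realType)
    (mu : {sigma_finite_measure set T -> \bar R})
    (nu : {finite_measure set T -> \bar R}) (p : T -> R) :
  measurable_fun setT p -> (forall x, 0 <= p x)%R ->
  (forall A, measurable A -> nu A = \int[mu]_(x in A) (p x)%:E) ->
  forall f : T -> \bar R, measurable_fun setT f -> (forall x, 0 <= f x) ->
  \int[nu]_x f x = \int[mu]_x (f x * (p x)%:E).
Proof.
move=> mp p0 nup f mf f0.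
have mpE : measurable_fun setT (EFin \o p) by exact/measurable_EFinP.
have numu : nu `<< mu.
  apply/null_content_dominatesP => A mA muA0.
  by rewrite nup// null_set_integral//; exact: measurable_funTS.
rewrite -(Radon_Nikodym_SigmaFinite.change_of_variables numu)//.
have rn := Radon_Nikodym_SigmaFinite.f_integrable numu.
apply: ge0_ae_eq_integral => //.
- by apply: emeasurable_funM => //; exact: measurable_int rn.
- exact: emeasurable_funM.
- by move=> x _; rewrite mule_ge0// Radon_Nikodym_SigmaFinite.f_ge0.
- by move=> x _; rewrite mule_ge0// lee_fin.
- apply: ae_eqe_mul2l; apply: integral_ae_eq => // A _ mA.
  by rewrite -Radon_Nikodym_SigmaFinite.f_integral// -nup.
Qed.

Section integral_product_pow.
Context d (T : measurableType d) (R : realType).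
Variable mu : {sigma_finite_measure set T -> \bar R}.

Lemma ge0_integral_product_powS n (F : n.+1.-tuple T -> \bar R) :
  measurable_fun setT F -> (forall t, 0 <= F t) ->
  \int[product_pow mu n.+1]_t F t =
  \int[mu]_x \int[product_pow mu n]_t F (cons_pair (x, t)).
Proof.
move=> mF F0 /=.
rewrite (ge0_integral_pushforward (@measurable_cons_pair _ T n)
  (mu \x product_pow mu n))//.
rewrite preimage_setT fubini_tonelli1//; last by move=> x; exact: F0.
by apply: (measurableT_comp mF); exact: measurable_cons_pair.
Qed.

Lemma integral_product_pow0 (F : 0.-tuple T -> \bar R) :
  measurable_fun setT F ->
  \int[product_pow mu 0]_t F t = F [tuple].
Proof. by move=> mF; rewrite /= integral_dirac// diracT mul1e. Qed.

Lemma measurable_cons_pairr n (F : n.+1.-tuple T -> \bar R) x :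
  measurable_fun setT F -> measurable_fun setT (fun t => F (cons_pair (x, t))).
Proof.
move=> mF; apply: (measurableT_comp mF).
by apply: (measurableT_comp (@measurable_cons_pair _ T n)); exact: measurable_pair1.
Qed.

Lemma measurable_integral_cons_pair n (F : n.+1.-tuple T -> \bar R) :
  measurable_fun setT F -> (forall t, 0 <= F t) ->
  measurable_fun setT
    (fun x => \int[product_pow mu n]_t F (cons_pair (x, t))).
Proof.
move=> mF F0.
apply: (@measurable_fun_fubini_tonelli_F _ _ _ _ _ (product_pow mu n)
  (F \o @cons_pair T n)); last by move=> x; exact: F0.
by apply: (measurableT_comp mF); exact: measurable_cons_pair.
Qed.

Lemma measurable_prod_tnth n (g : 'I_n -> T -> R) :
  (forall i, measurable_fun setT (g i)) ->
  measurable_fun setT (fun t : n.-tuple T => \prod_(i < n) g i (tnth t i))%R.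
Proof.
move=> mg; apply: measurable_prod => i _.
by apply: (measurableT_comp (mg i)); exact: measurable_tnth.
Qed.

Lemma ge0_integral_product_pow_prod n (g : 'I_n -> T -> R) :
  (forall i, measurable_fun setT (g i)) -> (forall i x, 0 <= g i x)%R ->
  \int[product_pow mu n]_t (\prod_(i < n) g i (tnth t i))%:E =
  \prod_(i < n) \int[mu]_x (g i x)%:E.
Proof.
elim: n g => [|n IH] g mg g0.
  rewrite integral_product_pow0; last first.
    by apply/measurable_EFinP; exact: (@measurable_prod_tnth 0).
  by rewrite !big_ord0.
rewrite ge0_integral_product_powS; last 2 first.
- by apply/measurable_EFinP; exact: measurable_prod_tnth.
- by move=> t; rewrite lee_fin prodr_ge0.
rewrite big_ord_recl -(IH (fun i => g (lift ord0 i)))//.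
have I0 : 0 <= \int[product_pow mu n]_t
    (\prod_(i < n) g (lift ord0 i) (tnth t i))%:E.
  by apply: integral_ge0 => t _; rewrite lee_fin prodr_ge0.
rewrite -ge0_integralZr//; last 2 first.
- exact/measurable_EFinP.
- by move=> x _; rewrite lee_fin.
apply: eq_integral => x _.
rewrite -ge0_integralZl//; last 3 first.
- apply/measurable_EFinP.
  exact: (@measurable_prod_tnth n (fun i => g (lift ord0 i))).
- by move=> t _; rewrite lee_fin prodr_ge0.
- by rewrite lee_fin.
apply: eq_integral => t _.
rewrite big_ord_recl EFinM; congr (_ * _%:E).
by apply: eq_bigr => i _; rewrite tnthS.
Qed.

End integral_product_pow.

(** The density hypothesis is taken in integral form because the induction applies it to a function
    of the first coordinate that is itself an integral over the others. *)
Lemma ge0_integral_product_pow_density d (T : measurableType d) (R : realType)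
    (mu nu : {sigma_finite_measure set T -> \bar R}) (p : T -> R) n
    (F : n.-tuple T -> \bar R) :
  measurable_fun setT p -> (forall x, 0 <= p x)%R ->
  (forall f : T -> \bar R, measurable_fun setT f -> (forall x, 0 <= f x) ->
    \int[nu]_x f x = \int[mu]_x (f x * (p x)%:E)) ->
  measurable_fun setT F -> (forall t, 0 <= F t) ->
  \int[product_pow nu n]_t F t =
  \int[product_pow mu n]_t (F t * (\prod_(i < n) p (tnth t i))%:E).
Proof.
move=> mp p0 nup; elim: n F => [|n IH] F mF F0.
  rewrite !integral_product_pow0//; first by rewrite big_ord0 mule1.
  apply: emeasurable_funM => //; apply/measurable_EFinP.
  exact: (measurable_prod_tnth (g := fun=> p)).
rewrite !ge0_integral_product_powS//; last 2 first.
- apply: emeasurable_funM => //; apply/measurable_EFinP.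
  exact: (measurable_prod_tnth (g := fun=> p)).
- by move=> t; rewrite mule_ge0// lee_fin prodr_ge0.
rewrite nup//; last 2 first.
- exact: measurable_integral_cons_pair.
- by move=> x; exact: integral_ge0.
apply: eq_integral => x _.
rewrite IH//; last exact: measurable_cons_pairr.
rewrite -ge0_integralZr//; last 3 first.
- apply: emeasurable_funM; first exact: measurable_cons_pairr.
  by apply/measurable_EFinP; exact: (measurable_prod_tnth (g := fun=> p)).
- by move=> t _; rewrite mule_ge0// lee_fin prodr_ge0.
- by rewrite lee_fin.
apply: eq_integral => t _; rewrite -muleA -EFinM big_ord_recl mulrC.
congr (_ * (_ * _)%:E); by apply: eq_bigr => i _; rewrite tnthS.
Qed.

Lemma measurable_tnth_rvec (R : realType) d (i : 'I_d) :
  measurable_fun [set: rvec R d] (fun x => tnth x i : R).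
Proof. exact: measurable_tnth. Qed.

(** * Translation invariance of Lebesgue measure *)

Section translation.
Context (R : realType).
Notation mu := (@lebesgue_measure R).

Let measurable_shift (a : R) : measurable_fun [set: measurableTypeR R]
  (+%R a : measurableTypeR R -> measurableTypeR R).
Proof. exact: measurable_realfun.measurable_funD. Qed.

Lemma lebesgue_measure_translation (a : R) (A : set (measurableTypeR R)) :
  measurable A ->
  pushforward mu (+%R a : measurableTypeR R -> measurableTypeR R) A = mu A.
Proof.
move=> mA.
(* Named explicitly: inference would select the measure instance that [Defs]
   declares on pushforwards of product measures. *)
pose nu := measure_function_pushforward__canonical__measure_function_Measure
  mu (@measurable_shift a).
apply/esym; apply: (@lebesgue_measure_unique R nu) => //.
move=> _ [[b c]] _ <-.
rewrite /nu /= /pushforward (_ : _ @^-1` _ = `](b - a)%R, (c - a)%R]%classic).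
  rewrite !lebesgue_measure_itv/= !lte_fin ltrD2r -!EFinB.
  by congr (if _ then _%:E else _); ring.
by apply/seteqP; split=> x /=; rewrite !in_itv/= ltrBlDl lerBrDl.
Qed.

Lemma ge0_integral_translation (a : R) (f : measurableTypeR R -> \bar R) :
  measurable_fun setT f -> (forall x, 0 <= f x) ->
  \int[mu]_x f (a + x)%R = \int[mu]_x f x.
Proof.
move=> mf f0; have ms := measurable_shift a.
transitivity (\int[pushforward mu
    (+%R a : measurableTypeR R -> measurableTypeR R)]_x f x).
  by rewrite (ge0_integral_pushforward ms mu (D := setT))// preimage_setT.
pose nu := measure_function_pushforward__canonical__measure_function_Measure
  mu (@measurable_shift a).
apply: (eq_measure_integral (m1 := nu) mu) => A mA _.
exact: lebesgue_measure_translation.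
Qed.

Lemma ge0_integral_lebesgue_pow_translation d (y : rvec R d)
    (F : rvec R d -> \bar R) :
  measurable_fun setT F -> (forall x, 0 <= F x) ->
  \int[lebesgue_pow R d]_x F (addv y x) = \int[lebesgue_pow R d]_x F x.
Proof.
rewrite /lebesgue_pow; elim: d y F => [|d IH] y F mF F0.
  have -> : (fun x => F (addv y x)) = F.
    by apply/funext => x; congr F; apply: eq_from_tnth => -[].
  by [].
have ma : measurable_fun [set: rvec R d.+1] (addv y).
  exact: (measurableT_comp (@measurable_addv R d.+1) (measurable_pair1 y)).
rewrite !ge0_integral_product_powS//; last exact: measurableT_comp.
case/tupleP: y ma => b y ma.
transitivity (\int[mu]_x \int[product_pow mu d]_t F (cons_pair (b + x, t)%R)).
  apply: eq_integral => x _.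
  rewrite -(IH y (fun t => F (cons_pair (b + x, t)%R)))//; last first.
    exact: measurable_cons_pairr.
  apply: eq_integral => t _; congr F; apply: eq_from_tnth => i.
  rewrite tnth_mktuple; case: (unliftP ord0 i) => [j ->|->].
    by rewrite !tnthS tnth_mktuple.
  by [].
rewrite (@ge0_integral_translation _ (fun x =>
  \int[product_pow mu d]_t F (cons_pair (x, t))))//.
- exact: measurable_integral_cons_pair.
- by move=> x; exact: integral_ge0.
Qed.

End translation.

(** * Isotropic Gaussian densities *)

Section gaussian_density.
Context (R : realType) (d : nat).
Implicit Types (x y : rvec R d).

Definition gauss_density (s : R) x : R :=
  (\prod_(i < d) normal_pdf 0 s (tnth x i))%R.

Lemma measurable_gauss_density s :
  measurable_fun [set: rvec R d] (gauss_density s).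
Proof.
apply: (measurable_prod_tnth (g := fun=> normal_pdf 0 s)) => i.
exact: measurable_normal_pdf.
Qed.

Lemma gauss_density_ge0 s x : (0 <= gauss_density s x)%R.
Proof. by apply: prodr_ge0 => i _; exact: normal_pdf_ge0. Qed.

Lemma gauss_densityE s x : s != 0%R ->
  gauss_density s x =
    (normal_peak s ^+ d * expR (- dotp x x / (s ^+ 2 *+ 2)))%R.
Proof.
move=> s0; rewrite /gauss_density normal_pdfE//.
under eq_bigr do rewrite /normal_fun subr0.
rewrite big_split/= prodr_const card_ord; congr (_ * _)%R.
rewrite -expR_sum; congr expR; rewrite -mulr_suml -sumrN /dotp; congr (_ / _)%R.
Qed.

Lemma dotp_ge0 x : (0 <= dotp x x)%R.
Proof. by apply: sumr_ge0 => i _; rewrite -expr2 sqr_ge0. Qed.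

Lemma gauss_density_le s x : s != 0%R ->
  (gauss_density s x <= normal_peak s ^+ d)%R.
Proof.
move=> s0; rewrite gauss_densityE// ler_piMr ?exprn_ge0 ?normal_peak_ge0//.
by rewrite -expR0 ler_expR mulNr oppr_le0 divr_ge0 ?dotp_ge0// mulrn_wge0// sqr_ge0.
Qed.

Lemma gauss_density_gt0 s x : s != 0%R -> (0 < gauss_density s x)%R.
Proof.
by move=> s0; rewrite gauss_densityE// mulr_gt0 ?expR_gt0// exprn_gt0// normal_peak_gt0.
Qed.

Lemma ge0_integral_gaussian s (F : rvec R d -> \bar R) :
  measurable_fun setT F -> (forall x, 0 <= F x) ->
  \int[gaussian d s]_x F x =
  \int[lebesgue_pow R d]_x (F x * (gauss_density s x)%:E).
Proof.
move=> mF F0; apply: (ge0_integral_product_pow_density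
  (mu := @lebesgue_measure R) (nu := normal_prob 0%R s)) => //.
- exact: measurable_normal_pdf.
- by move=> x; exact: normal_pdf_ge0.
- apply: ge0_integral_density => //.
  + exact: measurable_normal_pdf.
  + by move=> x; exact: normal_pdf_ge0.
Qed.

Lemma measurable_subv :
  measurable_fun [set: rvec R d * rvec R d] (fun p => subv p.1 p.2).
Proof.
apply/measurable_fun_tnthP => i.
rewrite (_ : _ \o _ = (fun p : rvec R d * rvec R d =>
    (tnth p.1 i : R) - (tnth p.2 i : R))%R); last first.
  by apply/funext => p /=; rewrite tnth_mktuple.
by apply: measurable_realfun.measurable_funB;
  apply: (measurableT_comp (measurable_tnth i)).
Qed.

Lemma measurable_subvl y : measurable_fun [set: rvec R d] (fun x => subv x y).
Proof. exact: (measurableT_comp measurable_subv (measurable_pair2 y)). Qed.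

Lemma measurable_subvr x : measurable_fun [set: rvec R d] (subv x).
Proof. exact: (measurableT_comp measurable_subv (measurable_pair1 x)). Qed.

Lemma measurable_addvr x : measurable_fun [set: rvec R d] (addv x).
Proof. exact: (measurableT_comp (@measurable_addv R d) (measurable_pair1 x)). Qed.

Lemma measurable_gauss_density_subv s :
  measurable_fun [set: rvec R d * rvec R d]
    (fun p => gauss_density s (subv p.1 p.2)).
Proof.
exact: (measurableT_comp (measurable_gauss_density s) measurable_subv).
Qed.

Lemma addvK x y : subv (addv y x) y = x.
Proof.
by apply: eq_from_tnth => i; rewrite !tnth_mktuple addrC addKr.
Qed.

End gaussian_density.
Arguments gauss_density {R d} s x.

(** * Smoothed densities and the entropy of a Gaussian convolution *)

Section smoothed_density.
Context (R : realType) (d : nat) (s : R).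
Hypothesis s0 : s != 0%R.
Implicit Types (mu : {finite_measure set (rvec R d) -> \bar R}) (x y : rvec R d).

(** For a finite measure the kernel is bounded by its peak, so the integral is finite and [fine]
    loses nothing. *)
Definition smoothed_density (mu : set (rvec R d) -> \bar R) x : R :=
  fine (\int[mu]_y (gauss_density s (subv x y))%:E).

Lemma integral_gauss_density_le mu x :
  \int[mu]_y (gauss_density s (subv x y))%:E <=
  (normal_peak s ^+ d)%:E * mu setT.
Proof.
rewrite -integral_cst//; apply: ge0_le_integral_nomeas => y.
- by rewrite lee_fin gauss_density_ge0.
- by rewrite lee_fin gauss_density_le.
Qed.

Lemma EFin_smoothed_density mu x :
  (smoothed_density mu x)%:E = \int[mu]_y (gauss_density s (subv x y))%:E.
Proof.
rewrite /smoothed_density fineK//.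
rewrite ge0_fin_numE; last first.
  by apply: integral_ge0 => y _; rewrite lee_fin gauss_density_ge0.
apply: (le_lt_trans (integral_gauss_density_le mu x)).
by rewrite lte_mul_pinfty// ?lee_fin ?exprn_ge0 ?normal_peak_ge0// ltey_eq fin_num_measure.
Qed.

Lemma smoothed_density_ge0 mu x : (0 <= smoothed_density mu x)%R.
Proof.
rewrite -lee_fin EFin_smoothed_density.
by apply: integral_ge0 => y _; rewrite lee_fin gauss_density_ge0.
Qed.

Lemma measurable_smoothed_density mu : measurable_fun setT (smoothed_density mu).
Proof.
apply/measurable_EFinP.
rewrite (_ : _ \o _ = fun x => \int[mu]_y (gauss_density s (subv x y))%:E); last first.
  by apply/funext => x /=; rewrite EFin_smoothed_density.
apply: (@measurable_fun_fubini_tonelli_F _ _ _ _ _ mu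
  (fun p => (gauss_density s (subv p.1 p.2))%:E)).
  by apply/measurable_EFinP; exact: measurable_gauss_density_subv.
by move=> p; rewrite lee_fin gauss_density_ge0.
Qed.

(** The mass of [A] is the double integral of its indicator at y + z. The substitution x = y + z in
    the inner integral moves y into the Gaussian kernel, and Tonelli's theorem then integrates the
    kernel over y first. *)
Lemma convolution_gaussianE mu (A : set (rvec R d)) : measurable A ->
  convolution mu (gaussian d s) A =
  \int[lebesgue_pow R d]_(x in A) (smoothed_density mu x)%:E.
Proof.
move=> mA.
have mI : measurable_fun [set: rvec R d] (fun x => (\1_A x : R)%:E).
  by apply/measurable_EFinP; exact: measurable_indic.
have mg y : measurable_fun [set: rvec R d] (fun x => (gauss_density s (subv x y))%:E).
  apply/measurable_EFinP.
  exact: (measurableT_comp (measurable_gauss_density s) (measurable_subvl y)).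
have g0 z : 0 <= (gauss_density s z : R)%:E by rewrite lee_fin gauss_density_ge0.
have I0 z : 0 <= (\1_A z : R)%:E by rewrite lee_fin.
have ma := @measurable_addv R d.
have mIa : measurable_fun [set: rvec R d * rvec R d]
    (fun p => (\1_A (addv p.1 p.2) : R)%:E) by exact: (measurableT_comp mI ma).
transitivity (\int[mu]_y \int[gaussian d s]_z (\1_A (addv y z) : R)%:E).
  rewrite -(fubini_tonelli1 (fun p => (\1_A (addv p.1 p.2) : R)%:E))//.
  have mB : measurable ((fun p : rvec R d * rvec R d => addv p.1 p.2) @^-1` A).
    by rewrite -[X in measurable X]setTI; exact: ma.
  rewrite /convolution /pushforward.
  by rewrite -[X in _ X = _]setIT -(integral_indic _ measurableT).
transitivity (\int[mu]_y \int[lebesgue_pow R d]_x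
    ((\1_A x : R)%:E * (gauss_density s (subv x y))%:E)).
  apply: eq_integral => y _.
  rewrite ge0_integral_gaussian//; last first.
    exact: (measurableT_comp mI (measurable_addvr y)).
  rewrite -[RHS](ge0_integral_lebesgue_pow_translation y).
  - by apply: eq_integral => z _; rewrite addvK.
  - exact: emeasurable_funM.
  - by move=> x; exact: mule_ge0.
rewrite (fubini_tonelli (fun p => (\1_A p.2 : R)%:E *
  (gauss_density s (subv p.2 p.1))%:E)); last 2 first.
- apply: emeasurable_funM.
    exact: (measurableT_comp mI measurable_snd).
  apply/measurable_EFinP.
  have ms : measurable_fun [set: rvec R d * rvec R d] (fun p => (p.2, p.1)).
    by apply: measurable_fun_pair; [exact: measurable_snd|exact: measurable_fst].
  exact: (measurableT_comp (@measurable_gauss_density_subv R d s) ms).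
- by move=> p; exact: mule_ge0.
rewrite [RHS]integral_mkcond; apply: eq_integral => x _ /=.
rewrite ge0_integralZl//; last first.
  apply/measurable_EFinP.
  exact: (measurableT_comp (measurable_gauss_density s) (measurable_subvr x)).
rewrite -EFin_smoothed_density patchE indicE.
by case: ifPn; rewrite ?mul1e ?mul0e.
Qed.

End smoothed_density.

(** By uniqueness of the Radon-Nikodym derivative the entropy can be computed with any version [p]
    of the density, in particular with one that satisfies pointwise bounds everywhere. *)
Lemma differential_entropyE (R : realType) d
    (mu : {finite_measure set (rvec R d) -> \bar R}) (p : rvec R d -> R) :
  measurable_fun setT p -> (forall x, 0 <= p x)%R ->
  (forall A, measurable A -> mu A = \int[lebesgue_pow R d]_(x in A) (p x)%:E) ->
  differential_entropy mu = - \int[lebesgue_pow R d]_x (p x * ln (p x))%:E.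
Proof.
move=> mp p0 mup; rewrite /differential_entropy; congr (- _).
have mpE : measurable_fun setT (EFin \o p) by exact/measurable_EFinP.
have numu : charge_of_finite_measure mu `<< lebesgue_pow R d.
  apply/null_content_dominatesP => A mA muA0.
  by rewrite [LHS]mup// null_set_integral//; exact: measurable_funTS.
have rn := Radon_Nikodym_integrable numu.
set f := Radon_Nikodym _ _.
have mf : measurable_fun setT (fine \o f).
  apply/measurable_EFinP; rewrite (_ : EFin \o _ = f).
    exact: measurable_int rn.
  by apply/funext => x /=; rewrite fineK// Radon_Nikodym_fin_num.
have mxlnx (g : rvec R d -> R) : measurable_fun setT g ->
    measurable_fun setT (fun x => (g x * ln (g x))%:E).
  move=> mg; apply/measurable_EFinP/measurable_funM => //.
  exact: (measurableT_comp (@measurable_ln R) mg).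
apply: ae_eq_integral => //; [exact: (mxlnx (fine \o f))|exact: mxlnx|].
suff : ae_eq (lebesgue_pow R d) setT f (EFin \o p).
  by apply: filterS => x /(_ Logic.I) fp _; rewrite fp.
apply: integral_ae_eq => // A _ mA.
by rewrite -Radon_Nikodym_integral// -mup.
Qed.

Lemma convolution_gaussian_entropy (R : realType) d (s : R)
    (mu : {finite_measure set (rvec R d) -> \bar R}) : s != 0%R ->
  differential_entropy (convolution mu (gaussian d s)) =
  - \int[lebesgue_pow R d]_x
      (smoothed_density s mu x * ln (smoothed_density s mu x))%:E.
Proof.
move=> s0; apply: differential_entropyE.
- exact: measurable_smoothed_density.
- by move=> x; exact: smoothed_density_ge0.
- by move=> A mA; exact: convolution_gaussianE.
Qed.

(** * Comparison of two entropies *)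

(** The difference splits as [a (ln b - ln a) - (b - a) (- ln b)]. Both terms are nonnegative; the
    first is at most [b - a] by [ln (1 + u) <= u], the second at most [(b - a) w], so the absolute
    value is bounded by the larger bound and not by their sum. *)
Lemma xlnx_dist_le (R : realType) (a b w : R) :
  (0 < a -> a <= b -> b <= 1 -> 1 <= w -> - ln b <= w ->
  `|b * ln b - a * ln a| <= (b - a) * w)%R.
Proof.
move=> a0 ab b1 w1 bw; have b0 : (0 < b)%R by exact: lt_le_trans ab.
have -> : (b * ln b - a * ln a = a * (ln b - ln a) - (b - a) * - ln b)%R by ring.
have lnab : (ln a <= ln b)%R by rewrite ler_ln.
have h1 : (0 <= a * (ln b - ln a))%R by rewrite mulr_ge0 ?subr_ge0// ltW.
have h2 : (a * (ln b - ln a) <= b - a)%R.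
  rewrite -ln_div//; apply: (@le_trans _ _ (a * (b / a - 1)))%R.
    rewrite ler_wpM2l ?(ltW a0)//; have := @le_ln1Dx R (b / a - 1)%R.
    by rewrite (addrC 1%R) subrK; apply; rewrite ltrBrDl subrr divr_gt0.
  by rewrite mulrBr mulr1 mulrCA divff ?mulr1// gt_eqF.
have lnb0 : (0 <= - ln b)%R by rewrite oppr_ge0 -ln1 ler_ln ?posrE.
have ba : (0 <= b - a)%R by rewrite subr_ge0.
have h3 : (0 <= (b - a) * - ln b <= (b - a) * w)%R.
  by rewrite mulr_ge0//= ler_wpM2l.
have h4 : (b - a <= (b - a) * w)%R by rewrite ler_peMr.
by rewrite ler_norml; lra.
Qed.

(** Scaling by [c] reduces to arguments in ]0, 1]. The weight is compared with [- ln (a / c)] only: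
    when [b] is the larger argument, [- ln (b / c)] is smaller still. *)
Lemma xlnx_dist_le_max (R : realType) (c a b w : R) :
  (0 < c -> 0 < a <= c -> 0 < b <= c -> 1 <= w -> - ln (a / c) <= w ->
  `|a * ln (a / c) - b * ln (b / c)| <= `|a - b| * w)%R.
Proof.
move=> c0 /andP[a0 ac] /andP[b0 bc] w1 aw.
have scale x y : (x * ln (x / c) - y * ln (y / c) =
    c * ((x / c) * ln (x / c) - (y / c) * ln (y / c)))%R.
  by field; rewrite gt_eqF.
have H x y : (0 < y -> y <= x -> x <= c -> - ln (x / c) <= w ->
    `|x * ln (x / c) - y * ln (y / c)| <= (x - y) * w)%R.
  move=> y0 yx xc xw; rewrite scale normrM gtr0_norm//.
  rewrite [leRHS](_ : _ = (c * ((x / c - y / c) * w))%R); last first.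
    by field; rewrite gt_eqF.
  rewrite ler_pM2l//; apply: xlnx_dist_le => //.
  - by rewrite divr_gt0.
  - by rewrite ler_pM2r// invr_gt0.
  - by rewrite ler_pdivrMr// mul1r.
have [ba|/ltW ab] := leP b a.
  by rewrite (ger0_norm (_ : 0 <= a - b)%R) ?subr_ge0//; exact: H.
rewrite distrC [X in (_ <= X * _)%R]distrC.
rewrite (ger0_norm (_ : 0 <= b - a)%R) ?subr_ge0//; apply: H => //.
apply: le_trans aw; rewrite lerN2 ler_ln ?posrE ?divr_gt0//.
by rewrite ler_pM2r// invr_gt0.
Qed.

(* The larger of two densities controls the logarithm, so the weight only has to
   dominate [- ln] of one of them. *)
Lemma entropy_dist_le d (T : measurableType d) (R : realType)
    (mu : {measure set T -> \bar R}) (c : R) (q r w : T -> R) :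
  (0 < c)%R ->
  measurable_fun setT q -> measurable_fun setT r -> measurable_fun setT w ->
  (forall x, 0 < q x <= c)%R -> (forall x, 0 < r x <= c)%R ->
  (forall x, 1 <= w x)%R -> (forall x, - ln (q x / c) <= w x)%R ->
  \int[mu]_x (q x)%:E = 1 -> \int[mu]_x (r x)%:E = 1 ->
  \int[mu]_x (q x * w x)%:E < +oo ->
  `| - (\int[mu]_x (q x * ln (q x))%:E) - - \int[mu]_x (r x * ln (r x))%:E |
  <= \int[mu]_x (`|q x - r x| * w x)%:E.
Proof.
move=> c0 mq mr mw qc rc w1 qw q1 r1 qwoo.
(* An infinite right-hand side is trivial; a finite one makes the difference of the two integrands
   integrable. *)
have [->|] := eqVneq (\int[mu]_x (`|q x - r x| * w x)%:E) +oo; first by rewrite leey.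
rewrite -ltey => dwoo.
have mxlnx (g : T -> R) : measurable_fun setT g ->
    measurable_fun setT (fun x => g x * ln (g x / c))%R.
  move=> mg; apply: measurable_funM => //.
  by apply: (measurableT_comp (@measurable_ln R)); exact: measurable_funM.
have w0 x : (0 <= w x)%R by exact: le_trans (w1 x).
have int_density (g : T -> R) : measurable_fun setT g -> (forall x, 0 < g x <= c)%R ->
    \int[mu]_x (g x)%:E = 1 -> mu.-integrable setT (EFin \o g).
  move=> mg gc g1; apply/integrableP; split; first exact/measurable_EFinP.
  under eq_integral => x _.
    rewrite /= ger0_norm; last by have /andP[/ltW] := gc x.
    over.
  by rewrite g1 ltry.
have iq := int_density _ mq qc q1; have ir := int_density _ mr rc r1.
have iQ : mu.-integrable setT (fun x => (q x * ln (q x / c))%:E).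
  apply: (@le_integrable _ _ _ mu _ measurableT _ (fun x => (q x * w x)%:E)).
  - by apply/measurable_EFinP; exact: mxlnx.
  - move=> x _; have /andP[q0 qc'] := qc x; rewrite lee_fin !normrM.
    rewrite ler_wpM2l// (ger0_norm (w0 x)) ler0_norm//.
    by rewrite -ln1 ler_ln ?posrE ?divr_gt0// ler_pdivrMr// mul1r.
  - apply/integrableP; split; first by apply/measurable_EFinP; exact: measurable_funM.
    under eq_integral => x _.
      rewrite /= ger0_norm; last first.
        by have /andP[/ltW q0 _] := qc x; exact: mulr_ge0.
      over.
    by [].
have iD : mu.-integrable setT
    (fun x => (q x * ln (q x / c) - r x * ln (r x / c))%:E).
  apply: (@le_integrable _ _ _ mu _ measurableT _ (fun x => (`|q x - r x| * w x)%:E)).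
  - by apply/measurable_EFinP; apply: measurable_realfun.measurable_funB; exact: mxlnx.
  - move=> x _; rewrite lee_fin [leRHS]ger0_norm ?mulr_ge0//.
    exact: xlnx_dist_le_max.
  - apply/integrableP; split.
      apply/measurable_EFinP/measurable_funM => //.
      by apply: measurableT_comp => //; exact: measurable_realfun.measurable_funB.
    under eq_integral => x _ do rewrite /= ger0_norm ?mulr_ge0//.
    by [].
(* No lower bound on [r] is available, so its integrability is deduced from that of the [q] term and
   of the difference. *)
have iR : mu.-integrable setT (fun x => (r x * ln (r x / c))%:E).
  rewrite (_ : (fun _ => _) = (fun x => (q x * ln (q x / c))%:E) \-
    (fun x => (q x * ln (q x / c) - r x * ln (r x / c))%:E)).
    exact: integrableB.
  by apply/funext => x /=; rewrite -EFinB; congr EFin; ring.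
(* Both densities have mass 1, so the normalisation by [c] adds the same [ln c] to both integrals
   and cancels in the difference. *)
have split_ln (g : T -> R) : (forall x, 0 < g x <= c)%R ->
    mu.-integrable setT (EFin \o g) ->
    mu.-integrable setT (fun x => (g x * ln (g x / c))%:E) ->
    \int[mu]_x (g x)%:E = 1 ->
    \int[mu]_x (g x * ln (g x))%:E =
    \int[mu]_x (g x * ln (g x / c))%:E + (ln c)%:E.
  move=> gc ig iG g1; rewrite -[X in _ = _ + X]mule1 -g1 -integralZl//.
  rewrite -integralD//; last exact: integrableZl.
  apply: eq_integral => x _; rewrite -EFinM -EFinD; congr EFin.
  have /andP[g0 _] := gc x; rewrite ln_div ?posrE//; ring.
rewrite (split_ln q)// (split_ln r)//.
have fq : \int[mu]_x (q x * ln (q x / c))%:E \is a fin_num by exact: integrable_fin_num.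
have fr : \int[mu]_x (r x * ln (r x / c))%:E \is a fin_num by exact: integrable_fin_num.
rewrite [X in `|X|](_ : _ = - \int[mu]_x
    (q x * ln (q x / c) - r x * ln (r x / c))%:E); last first.
  under [in RHS]eq_integral do rewrite EFinB.
  rewrite integralB//= -(fineK fq) -(fineK fr) !(=^~ EFinN, =^~ EFinD).
  by congr EFin; ring.
rewrite abseN; apply: (le_trans (le_abse_integral _ measurableT _)).
  exact: measurable_int iD.
apply: ge0_le_integral_nomeas => x; first exact: abse_ge0.
by rewrite lee_fin; exact: xlnx_dist_le_max.
Qed.

(** * Moments of a subgaussian variable *)

(** In the sum of the two exponential series odd terms cancel and even terms are nonnegative, so the
    first five terms give a lower bound. *)
Lemma cosh_ge (R : realType) (u : R) :
  (1 + u ^+ 2 / 2 + u ^+ 4 / 24 <= (expR u + expR (- u)) / 2)%R.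
Proof.
have cu := is_cvg_series_exp_coeff u; have cNu := is_cvg_series_exp_coeff (- u)%R.
have ge0 n : (0 <= (exp_coeff u + exp_coeff (- u)) n)%R.
  rewrite /= /exp_coeff fctE/= exprNn -mulrDl divr_ge0// -signr_odd.
  have [on|en] := boolP (odd n); first by rewrite expr1 mulN1r subrr.
  by rewrite expr0 mul1r addr_ge0// exprn_even_ge0.
rewrite ler_pdivlMr// /expR -lim_seriesD//.
have := @nondecreasing_cvgn_le R (series (exp_coeff u + exp_coeff (- u))%R).
move=> /(_ _ (is_cvg_seriesD cu cNu) 5%N) H.
apply: le_trans (H _); last by apply: nondecreasing_series => n _ _; exact: ge0.
rewrite /series/= !big_nat_recr//= big_geq// /exp_coeff !fctE/=.
rewrite (_ : 4`! = 24)%N// (_ : 3`! = 6)%N//.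
rewrite (_ : 2`! = 2)%N// (_ : 1`! = 1)%N// fact0.
by rewrite le_eqVlt; apply/orP; left; apply/eqP; field.
Qed.

(** From [exp (- 1/6) >= 5/6] one gets [exp (1/6) <= 6/5], and (6/5)^6 = 2.985984. Splitting 1 into
    five parts would give (5/4)^5 > 3. *)
Lemma expR1_le3 (R : realType) : (expR 1 <= 3 :> R)%R.
Proof.
have -> : (1 = 6%:R * 6^-1 :> R)%R by field.
rewrite expRM_natl.
have h : (expR 6^-1 <= 6 / 5 :> R)%R.
  have := expR_ge1Dx (- 6^-1 : R)%R; have := expRxMexpNx_1 (6^-1 : R)%R.
  by have := expR_gt0 (6^-1 : R)%R; nra.
apply: (@le_trans _ _ ((6 / 5) ^+ 6))%R; last by lra.
by rewrite lerXn2r ?nnegrE ?expR_ge0//; lra.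
Qed.

(** This is how [3 / 8] enters: the kernel estimate yields a factor [sqrt 2] per dimension. After
    squaring, [exp (1/8) >= 9/8] is enough, since (9/8)^6 exceeds 2. *)
Lemma sqrt2_le_expR (R : realType) : (Num.sqrt 2 <= expR (3 / 8) :> R)%R.
Proof.
rewrite -(@ler_pXn2r _ 2) ?nnegrE ?expR_ge0// sqr_sqrtr//.
rewrite expRM_natl.
apply: (@le_trans _ _ ((9 / 8) ^+ 3 ^+ 2))%R; first lra.
have h : (9 / 8 <= expR 8^-1 :> R)%R by have := expR_ge1Dx (8^-1 : R)%R; lra.
by rewrite -!exprM lerXn2r ?nnegrE ?expR_ge0//; lra.
Qed.

Section subgaussian_moments.
Context d (T : measurableType d) (R : realType) (P : probability T R).
Variables (X : T -> R) (K : R).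
Hypotheses (mX : measurable_fun setT X) (K0 : (0 < K)%R).
Hypothesis mgfX : forall t : R,
  \int[P]_x (expR (t * X x))%:E <= (expR (2^-1 * K ^+ 2 * t ^+ 2))%:E.

(** Chosen so that [K^2 t^2 / 2 = 1]: the moment generating function at [t] and [- t] is then at
    most e. *)
Let t : R := (Num.sqrt 2 / K)%R.

Let t2 : (t ^+ 2 = 2 / K ^+ 2)%R.
Proof. by rewrite /t expr_div_n sqr_sqrtr. Qed.

Let mexp (s : R) : measurable_fun setT (fun x => (expR (s * X x))%:E).
Proof.
by apply/measurable_EFinP/measurableT_comp => //; exact: measurable_funM.
Qed.

Let integral_cosh :
  \int[P]_x ((expR (t * X x) + expR (- (t * X x))) / 2)%:E <= 3%:E.
Proof.
under eq_integral do rewrite EFinM EFinD -mulNr.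
rewrite ge0_integralZr//; first last.
- by move=> x _; rewrite -EFinD lee_fin addr_ge0// expR_ge0.
- by apply: emeasurable_funD; exact: mexp.
rewrite ge0_integralD//.
have e (s : R) : (s ^+ 2 = t ^+ 2)%R -> \int[P]_x (expR (s * X x))%:E <= 3%:E.
  move=> st; apply: (le_trans (mgfX s)); rewrite lee_fin st t2.
  rewrite (_ : (_ * _)%R = 1%R); first exact: expR1_le3.
  by field; rewrite gt_eqF.
have e1 := e t erefl; have e2 := e (- t)%R (sqrrN t).
rewrite (_ : 3%:E = (3%:E + 3%:E) * (2^-1)%:E); last first.
  by rewrite -EFinD -EFinM; congr EFin; field.
by rewrite lee_pmul2r// leeD.
Qed.

(** The mean of [cosh (t X)] is at most 3, so its excess over 1 has mean at most 2. The constant is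
    added to [g] inside the integral, and subtracted only once finiteness is known. *)
Let moment_le (g : T -> R) (c : R) : (0 <= c)%R -> measurable_fun setT g ->
  (forall x, 0 <= g x)%R ->
  (forall x, g x <= c * ((expR (t * X x) + expR (- (t * X x))) / 2 - 1))%R ->
  \int[P]_x (g x)%:E <= (c * 2)%:E.
Proof.
move=> c0 mg g0 gc.
have mE : measurable_fun setT (EFin \o g) by exact/measurable_EFinP.
have H : \int[P]_x (g x)%:E + c%:E <= (c * 3)%:E.
  rewrite -[c%:E in X in X <= _]mule1 -(probability_setT P) -integral_cst//.
  rewrite -ge0_integralD//; [|by move=> x _; rewrite lee_fin].
  rewrite EFinM; apply: le_trans (lee_wpmul2l _ integral_cosh); last by rewrite lee_fin.
  rewrite -ge0_integralZl//; last first.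
    under eq_fun do rewrite EFinM EFinD -mulNr.
    apply: emeasurable_funM; last exact: measurable_cst.
    by apply: emeasurable_funD; exact: mexp.
  apply: ge0_le_integral_nomeas => x; first by rewrite -EFinD lee_fin addr_ge0.
  by rewrite -EFinD -EFinM lee_fin; have := gc x; lra.
have ff : \int[P]_x (g x)%:E \is a fin_num.
  rewrite ge0_fin_numE; last by apply: integral_ge0 => x _; rewrite lee_fin.
  apply: le_lt_trans (ltry (c * 3)%R); apply: le_trans H.
  by rewrite leeDl// lee_fin.
by move: H; rewrite -(fineK ff) -EFinD !lee_fin; lra.
Qed.

(** The quadratic term [(t X)^2 / 2] of cosh is [X^2 / K^2]. For the fourth moment below, the
    quartic term [(t X)^4 / 24] is [X^4 / (6 K^4)]. *)
Lemma subgaussian_moment2 : \int[P]_x (X x ^+ 2)%:E <= (2 * K ^+ 2)%:E.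
Proof.
rewrite mulrC; apply: moment_le => [||x|x].
- by rewrite sqr_ge0.
- exact: measurable_funX.
- exact: sqr_ge0.
have := @cosh_ge R (t * X x); rewrite exprMn t2.
set C := ((_ + _) / 2)%R => H.
have -> : (X x ^+ 2 = K ^+ 2 * (2 / K ^+ 2 * X x ^+ 2 / 2))%R.
  by field; rewrite gt_eqF.
rewrite ler_wpM2l ?sqr_ge0//.
by have : (0 <= (t * X x) ^+ 4)%R; [exact: exprn_even_ge0|lra].
Qed.

Lemma subgaussian_moment4 : \int[P]_x (X x ^+ 4)%:E <= (12 * K ^+ 4)%:E.
Proof.
rewrite (_ : 12 * K ^+ 4 = 6 * K ^+ 4 * 2)%R; last by ring.
apply: moment_le => [||x|x].
- by rewrite mulr_ge0// exprn_even_ge0.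
- exact: measurable_funX.
- exact: exprn_even_ge0.
have := @cosh_ge R (t * X x).
set C := ((_ + _) / 2)%R => H.
have -> : (X x ^+ 4 = 6 * K ^+ 4 * ((t * X x) ^+ 4 / 24))%R.
  by rewrite exprMn (exprM t 2 2) t2; field; rewrite gt_eqF.
rewrite ler_wpM2l ?mulr_ge0 ?exprn_ge0 ?(ltW K0)//.
by have : (0 <= (t * X x) ^+ 2)%R; [exact: exprn_even_ge0|lra].
Qed.

End subgaussian_moments.

(** * One-dimensional Gaussian integrals *)

Section normal_integrals.
Context (R : realType).
Notation leb := (@lebesgue_measure R).

Lemma normal_peak_gt0E (s : R) : (0 < s)%R ->
  normal_peak s = (s * Num.sqrt (pi *+ 2))^-1%R.
Proof.
move=> s0; rewrite /normal_peak -mulrnAr sqrtrM ?sqr_ge0//.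
by rewrite sqrtr_sqr gtr0_norm.
Qed.

Let sqrt2pi_gt0 : (0 < Num.sqrt (pi *+ 2) :> R)%R.
Proof. by rewrite sqrtr_gt0 mulrn_wgt0// pi_gt0. Qed.

(** The Gaussian integrals below are evaluated by completing the square, which turns the integrand
    into a constant times a normal density with another mean and deviation. *)
Lemma integral_scaled_normal_pdf (c m s : R) : (0 <= c)%R ->
  \int[leb]_x (c * normal_pdf m s x)%:E = c%:E.
Proof.
move=> c0; under eq_integral do rewrite EFinM.
rewrite ge0_integralZl//.
- by rewrite integral_normal_pdf mule1.
- by apply/measurable_EFinP; exact: measurable_normal_pdf.
- by move=> x _; rewrite lee_fin normal_pdf_ge0.
Qed.

Lemma ge0_integral_normal_prob (m s : R) (f : R -> R) :
  measurable_fun setT f -> (forall x, 0 <= f x)%R ->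
  \int[normal_prob m s]_x (f x)%:E = \int[leb]_x (f x * normal_pdf m s x)%:E.
Proof.
move=> mf f0; rewrite (@ge0_integral_density _ _ _ leb (normal_prob m s)
  (normal_pdf m s))//.
- exact: measurable_normal_pdf.
- by move=> x; exact: normal_pdf_ge0.
- exact/measurable_EFinP.
Qed.

Lemma normal_mgf (s t : R) : (0 < s)%R ->
  \int[normal_prob 0%R s]_x (expR (t * x))%:E = (expR (2^-1 * s ^+ 2 * t ^+ 2))%:E.
Proof.
move=> s0; rewrite ge0_integral_normal_prob; last 2 first.
- by apply: measurableT_comp => //; exact: measurable_funM.
- by move=> x; exact: expR_ge0.
rewrite -[RHS](integral_scaled_normal_pdf (s ^+ 2 * t) s (expR_ge0 _)).
apply: eq_integral => x _; congr EFin.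
rewrite !normal_pdfE ?gt_eqF// /normal_fun mulrCA [RHS]mulrCA -!expRD.
by congr (_ * expR _)%R; field; rewrite gt_eqF.
Qed.

Lemma normal_exp_sqr (c : R) : (0 <= c < 1)%R ->
  \int[normal_prob 0%R 1]_x (expR (c * x ^+ 2 / 2))%:E =
  ((Num.sqrt (1 - c))^-1)%:E.
Proof.
move=> /andP[c0 c1]; rewrite ge0_integral_normal_prob; last 2 first.
- apply: measurableT_comp => //; apply: measurable_funM => //.
  by apply: measurable_funM => //; exact: measurable_funX.
- by move=> x; exact: expR_ge0.
have r0 : (0 < Num.sqrt (1 - c))%R by rewrite sqrtr_gt0 subr_gt0.
have r2 : (Num.sqrt (1 - c) ^+ 2 = 1 - c)%R by rewrite sqr_sqrtr// subr_ge0 ltW.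
have i0 : (0 <= (Num.sqrt (1 - c))^-1)%R by rewrite invr_ge0 ltW.
rewrite -[RHS](integral_scaled_normal_pdf 0 (Num.sqrt (1 - c))^-1 i0).
apply: eq_integral => x _; congr EFin.
rewrite !normal_pdfE ?gt_eqF ?invr_gt0// !normal_peak_gt0E ?invr_gt0//.
rewrite /normal_fun mulrCA -!expRD.
have -> : (c * x ^+ 2 / 2 + - (x - 0) ^+ 2 / (1 ^+ 2 *+ 2) =
    - (x - 0) ^+ 2 / ((Num.sqrt (1 - c))^-1 ^+ 2 *+ 2))%R.
  rewrite exprVn r2; field; rewrite subr_eq0 gt_eqF//=.
by field; rewrite !gt_eqF.
Qed.

(** The integrand has precision [2 / s^2 - 1 / a^2 = 2 b^2 / (a s)^2], so it is a multiple of the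
    normal density of variance [(a s)^2 / (2 b^2)] centred at [w a^2 / b^2]. A positive [b^2]
    expresses convergence. *)
Lemma normal_pdf_sqr_div (s a b w : R) : (0 < s)%R -> (0 < a)%R -> (0 < b)%R ->
  (b ^+ 2 = a ^+ 2 - s ^+ 2 / 2)%R ->
  \int[leb]_x (normal_pdf 0 s (x - w) ^+ 2 / normal_pdf 0 a x)%:E =
  (a ^+ 2 / (Num.sqrt 2 * s * b) * expR (w ^+ 2 / (b ^+ 2 *+ 2)))%:E.
Proof.
move=> s0 a0 b0 bE; set c := (_ * expR _)%R.
have r2 : (0 < Num.sqrt 2 :> R)%R by rewrite sqrtr_gt0.
have c0 : (0 <= c)%R.
  by rewrite mulr_ge0 ?expR_ge0// divr_ge0 ?sqr_ge0// !mulr_ge0 ?ltW.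
pose v := (a * s / (Num.sqrt 2 * b))%R.
have v0 : (0 < v)%R by rewrite divr_gt0// mulr_gt0.
rewrite -[RHS](integral_scaled_normal_pdf (w * a ^+ 2 / b ^+ 2) v c0).
apply: eq_integral => x _; congr EFin.
rewrite !normal_pdfE ?gt_eqF// !normal_peak_gt0E// /normal_fun.
have r22 : (Num.sqrt 2 ^+ 2 = 2 :> R)%R by rewrite sqr_sqrtr.
have q0 := sqrt2pi_gt0; set q := Num.sqrt (pi *+ 2) in q0 *.
rewrite /c; set e3 := expR (w ^+ 2 / _).
set e1 := expR (- (x - w - 0) ^+ 2 / _); set e2 := expR (- (x - 0) ^+ 2 / _).
set e4 := expR (_ / (v ^+ 2 *+ 2)).
have ee : (e1 ^+ 2 / e2 = e3 * e4)%R.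
  rewrite /e1 /e2 /e3 /e4 -expRM_natl -expRN -!expRD; congr expR.
  rewrite /v exprMn exprVn [((_ * b) ^+ 2)%R]exprMn r22 exprMn bE.
  have b2 : (0 < b ^+ 2)%R by rewrite exprn_gt0.
  by field; rewrite (gt_eqF s0) (gt_eqF a0) gt_eqF//; lra.
have e20 : e2 != 0%R by rewrite gt_eqF// expR_gt0.
transitivity ((s * q)^-1 ^+ 2 * (a * q) * (e1 ^+ 2 / e2))%R.
  by field; rewrite e20 !gt_eqF.
by rewrite ee /v; field; rewrite !gt_eqF.
Qed.

End normal_integrals.

Lemma measurable_inv_gt0 d (T : measurableType d) (R : realType) (f : T -> R) :
  measurable_fun setT f -> (forall x, 0 < f x)%R ->
  measurable_fun setT (fun x => (f x)^-1)%R.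
Proof.
move=> mf f0; rewrite (_ : (fun _ => _) = (fun x => expR (- ln (f x)))).
  apply: measurableT_comp => //; apply: measurableT_comp => //.
  exact: (measurableT_comp (@measurable_ln R)).
by apply/funext => x; rewrite expRN lnK// posrE.
Qed.

(** * Gaussian kernels in dimension d and the chi-square integral *)

Section gaussian_kernel_bounds.
Context (R : realType) (d : nat).
Implicit Types (x y m : rvec R d).

Lemma tnth_subv x y i : tnth (subv x y) i = (tnth x i - tnth y i)%R.
Proof. by rewrite tnth_mktuple. Qed.

Lemma measurable_dotp_subv m :
  measurable_fun [set: rvec R d] (fun x => dotp (subv x m) (subv x m)).
Proof.
apply: measurable_sum => i; apply: measurable_funM;
  exact: (measurableT_comp (measurable_tnth i) (measurable_subvl m)).
Qed.

Lemma gauss_density_sqr_div (s a b : R) y m :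
  (0 < s)%R -> (0 < a)%R -> (0 < b)%R -> (b ^+ 2 = a ^+ 2 - s ^+ 2 / 2)%R ->
  \int[lebesgue_pow R d]_x
    (gauss_density s (subv x y) ^+ 2 / gauss_density a (subv x m))%:E =
  ((a ^+ 2 / (Num.sqrt 2 * s * b)) ^+ d *
    expR (dotp (subv y m) (subv y m) / (b ^+ 2 *+ 2)))%:E.
Proof.
move=> s0 a0 b0 bE.
pose g i u := (normal_pdf 0 s (u - (tnth y i - tnth m i)) ^+ 2 / normal_pdf 0 a u)%R.
have mg i : measurable_fun [set: measurableTypeR R] (g i).
  apply: measurable_funM.
    apply: measurable_funX.
    apply: (measurableT_comp (measurable_normal_pdf 0%R s)).
    exact: measurable_realfun.measurable_funB.
  apply: measurable_inv_gt0; first exact: measurable_normal_pdf.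
  move=> u; rewrite normal_pdfE ?gt_eqF// mulr_gt0 ?expR_gt0//.
  by rewrite normal_peak_gt0// gt_eqF.
rewrite -(ge0_integral_lebesgue_pow_translation m); last 2 first.
- apply/measurable_EFinP/measurable_funM.
    apply: measurable_funX.
    exact: (measurableT_comp (measurable_gauss_density s) (measurable_subvl y)).
  apply: measurable_inv_gt0.
    exact: (measurableT_comp (measurable_gauss_density a) (measurable_subvl m)).
  by move=> x; rewrite gauss_density_gt0// gt_eqF.
- by move=> x; rewrite lee_fin divr_ge0 ?sqr_ge0 ?gauss_density_ge0.
transitivity (\int[lebesgue_pow R d]_x (\prod_(i < d) g i (tnth x i))%:E).
  apply: eq_integral => x _; congr EFin.
  rewrite addvK /gauss_density -prodrXl -prodf_div; apply: eq_bigr => i _.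
  rewrite /g tnth_subv tnth_mktuple; congr (normal_pdf _ _ _ ^+ 2 / _)%R; ring.
rewrite ge0_integral_product_pow_prod//; last first.
  by move=> i u; rewrite divr_ge0 ?sqr_ge0 ?normal_pdf_ge0.
under eq_bigr do rewrite (normal_pdf_sqr_div _ s0 a0 b0 bE).
rewrite prodEFin; congr EFin.
rewrite big_split/= prodr_const card_ord -expR_sum; congr (_ * expR _)%R.
rewrite /dotp mulr_suml; apply: eq_bigr => i _.
by rewrite tnth_subv expr2.
Qed.

Lemma gaussian_mgf (s : R) m : (0 < s)%R ->
  \int[gaussian d s]_x (expR (dotp m x))%:E = (expR (2^-1 * s ^+ 2 * dotp m m))%:E.
Proof.
move=> s0; pose g i u := expR (tnth m i * u).
transitivity (\int[gaussian d s]_x (\prod_(i < d) g i (tnth x i))%:E).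
  by apply: eq_integral => x _; rewrite -expR_sum.
rewrite ge0_integral_product_pow_prod//; last 2 first.
- by move=> i; apply: measurableT_comp => //; exact: measurable_funM.
- by move=> i u; exact: expR_ge0.
under eq_bigr do rewrite (normal_mgf _ s0).
rewrite prodEFin -expR_sum; congr (expR _)%:E.
by rewrite mulr_sumr; apply: eq_bigr => i _; rewrite expr2.
Qed.

Lemma gaussian_exp_sqr (c : R) : (0 <= c < 1)%R ->
  \int[gaussian d 1]_x (expR (c * dotp x x / 2))%:E =
  ((Num.sqrt (1 - c))^-1 ^+ d)%:E.
Proof.
move=> c01; pose g (_ : 'I_d) u := expR (c * u ^+ 2 / 2).
transitivity (\int[gaussian d 1]_x (\prod_(i < d) g i (tnth x i))%:E).
  apply: eq_integral => x _; rewrite -expR_sum; congr (expR _)%:E.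
  by rewrite -mulr_suml -mulr_sumr; congr (_ * _ / _)%R.
rewrite ge0_integral_product_pow_prod//; last 2 first.
- move=> i; apply: measurableT_comp => //; apply: measurable_funM => //.
  by apply: measurable_funM => //; exact: measurable_funX.
- by move=> i u; exact: expR_ge0.
under eq_bigr do rewrite (normal_exp_sqr c01).
by rewrite prodEFin prodr_const card_ord.
Qed.

Lemma measurable_dotp :
  measurable_fun [set: rvec R d * rvec R d] (fun p => dotp p.1 p.2).
Proof.
apply: measurable_sum => i; apply: measurable_funM.
  exact: (measurableT_comp (measurable_tnth i) measurable_fst).
exact: (measurableT_comp (measurable_tnth i) measurable_snd).
Qed.

Lemma dotpZl (c : R) x y :
  dotp [tuple (c * tnth x i)%R | i < d] y = (c * dotp x y)%R.
Proof.
by rewrite /dotp mulr_sumr; apply: eq_bigr => i _; rewrite tnth_mktuple mulrA.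
Qed.

Lemma dotpC x y : dotp x y = dotp y x.
Proof. by apply: eq_bigr => i _; rewrite mulrC. Qed.

(* [exp (|v|^2 / (2 b^2))] is the moment generating function of a Gaussian vector,
   so exchanging the two expectations only uses the subgaussian bound. *)
Lemma subgaussian_exp_sqr (K b : R) (P : probability (rvec R d) R) :
  (0 < K)%R -> (K < b)%R -> subgaussian K P ->
  \int[P]_y (expR (dotp (subv y (mean P)) (subv y (mean P)) / (b ^+ 2 *+ 2)))%:E
  <= ((Num.sqrt (1 - K ^+ 2 / b ^+ 2))^-1 ^+ d)%:E.
Proof.
move=> K0 Kb [_ mgfP]; have b0 : (0 < b)%R by exact: lt_trans Kb.
set m := mean P.
pose F (p : rvec R d * rvec R d) := expR (b^-1 * dotp (subv p.1 m) p.2).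
have mF : measurable_fun setT (fun p => (F p)%:E).
  apply/measurable_EFinP/measurableT_comp => //; apply: measurable_funM => //.
  have mp : measurable_fun [set: rvec R d * rvec R d] (fun p => (subv p.1 m, p.2)).
    apply: measurable_fun_pair; last exact: measurable_snd.
    exact: (measurableT_comp (measurable_subvl m) measurable_fst).
  exact: (measurableT_comp measurable_dotp mp).
have F0 p : 0 <= (F p)%:E by rewrite lee_fin expR_ge0.
rewrite [leLHS](_ : _ = \int[P]_y \int[gaussian d 1]_z (F (y, z))%:E); last first.
  apply: eq_integral => y _.
  under [RHS]eq_integral do rewrite /F /= -dotpZl.
  rewrite gaussian_mgf// dotpZl dotpC dotpZl; congr (expR _)%:E.
  by field; rewrite gt_eqF.
rewrite (fubini_tonelli (fun p => (F p)%:E))//.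
(* The subgaussian bound in direction [z / b] gives the exponent [(K^2 / b^2) |z|^2 / 2], integrable
   against the standard Gaussian since [K < b]. *)
have c01 : (0 <= K ^+ 2 / b ^+ 2 < 1)%R.
  rewrite divr_ge0 ?sqr_ge0//= ltr_pdivrMr ?exprn_gt0// mul1r.
  by rewrite ltrXn2r// ltW.
rewrite -(gaussian_exp_sqr c01); apply: ge0_le_integral_nomeas => z.
  by apply: integral_ge0 => y _; exact: F0.
apply: (@le_trans _ _ (\int[P]_y
    (expR (dotp [tuple (b^-1 * tnth z i)%R | i < d] (subv y m)))%:E)).
  by under eq_integral do rewrite /F /= dotpC -dotpZl.
apply: (le_trans (mgfP _)); rewrite lee_fin ler_expR dotpZl dotpC dotpZl.
by rewrite le_eqVlt; apply/orP; left; apply/eqP; field; rewrite gt_eqF.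
Qed.

(** Per dimension, the factor [1 / b] of the kernel integral and the factor [(1 - K^2 / b^2)^(-1/2)]
    of the exponential moment combine into [(b^2 - K^2)^(-1/2)]. *)
Lemma chi_square_bound (K s a b : R) (P : probability (rvec R d) R) :
  (0 < K)%R -> (K < b)%R -> (0 < s)%R -> (0 < a)%R ->
  (b ^+ 2 = a ^+ 2 - s ^+ 2 / 2)%R -> subgaussian K P ->
  \int[P]_y \int[lebesgue_pow R d]_x
    (gauss_density s (subv x y) ^+ 2 / gauss_density a (subv x (mean P)))%:E <=
  ((a ^+ 2 / (Num.sqrt 2 * s * Num.sqrt (b ^+ 2 - K ^+ 2))) ^+ d)%:E.
Proof.
move=> K0 Kb s0 a0 bE sgP; have b0 : (0 < b)%R by exact: lt_trans Kb.
under eq_integral do rewrite (gauss_density_sqr_div _ _ s0 a0 b0 bE) EFinM.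
have r2 : (0 < Num.sqrt 2 :> R)%R by rewrite sqrtr_gt0.
have c0 : (0 <= (a ^+ 2 / (Num.sqrt 2 * s * b)) ^+ d)%R.
  by rewrite exprn_ge0// divr_ge0 ?sqr_ge0// !mulr_ge0 ?ltW.
rewrite ge0_integralZl//; last first.
  apply/measurable_EFinP/measurableT_comp => //; apply: measurable_funM => //.
  exact: measurable_dotp_subv.
apply: (le_trans (lee_wpmul2l _ (subgaussian_exp_sqr K0 Kb sgP))).
  by rewrite lee_fin.
rewrite -EFinM lee_fin -exprMn le_eqVlt; apply/orP; left; apply/eqP; congr (_ ^+ _)%R.
have bK : (0 < b ^+ 2 - K ^+ 2)%R by rewrite subr_gt0 ltrXn2r// ltW.
have -> : (1 - K ^+ 2 / b ^+ 2 = (b ^+ 2 - K ^+ 2) * b^-1 ^+ 2)%R.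
  by field; rewrite gt_eqF.
rewrite sqrtrM ?ltW// sqrtr_sqr gtr0_norm ?invr_gt0//.
have q0 : (0 < Num.sqrt (b ^+ 2 - K ^+ 2))%R by rewrite sqrtr_gt0.
by field; rewrite !gt_eqF.
Qed.

End gaussian_kernel_bounds.

(** * Variance of an empirical mean *)

Section empirical_mean.
Context d (T : measurableType d) (R : realType) (P : probability T R).
Variables (g : T -> R) (B : R).
Hypotheses (mg : measurable_fun setT g) (g0 : forall x, (0 <= g x)%R).
Hypothesis gB : forall x, (g x <= B)%R.

Let G := fine (\int[P]_x (g x)%:E).
Let G2 := fine (\int[P]_x (g x ^+ 2)%:E).
Let sumg n (t : n.-tuple T) : R := (\sum_(i < n) g (tnth t i))%R.

Let integral_le_cst (f : T -> R) (C : R) : (forall x, 0 <= f x <= C)%R ->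
  \int[P]_x (f x)%:E \is a fin_num.
Proof.
move=> fC; rewrite ge0_fin_numE; last first.
  by apply: integral_ge0 => x _; rewrite lee_fin; have /andP[] := fC x.
apply: (@le_lt_trans _ _ (\int[P]_x (cst C%:E) x)).
  by apply: ge0_le_integral_nomeas => x; rewrite lee_fin; have /andP[] := fC x.
by rewrite integral_cst// [X in _ * X](@probability_setT _ _ _ P) mule1 ltry.
Qed.

Let GE : \int[P]_x (g x)%:E = G%:E.
Proof. by rewrite /G fineK// (integral_le_cst (C := B))// => x; rewrite g0 gB. Qed.

Let G2E : \int[P]_x (g x ^+ 2)%:E = G2%:E.
Proof.
rewrite /G2 fineK// (integral_le_cst (C := B ^+ 2)%R)// => x.
by rewrite sqr_ge0 lerXn2r// nnegrE// (le_trans (g0 x)).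
Qed.

Let G0 : (0 <= G)%R.
Proof. by apply: fine_ge0; apply: integral_ge0 => x _; rewrite lee_fin. Qed.

Let sumg_ge0 n (t : n.-tuple T) : (0 <= sumg t)%R.
Proof. exact: sumr_ge0. Qed.

Let measurable_sumg n : measurable_fun [set: n.-tuple T] (@sumg n).
Proof.
apply: measurable_sum => i; apply: (measurableT_comp mg).
exact: measurable_tnth.
Qed.

Let sumg_cons n x (t : n.-tuple T) : sumg (cons_pair (x, t)) = (g x + sumg t)%R.
Proof.
rewrite /sumg big_ord_recl; congr (_ + _)%R.
by apply: eq_bigr => i _; rewrite tnthS.
Qed.

Let integral_addc d' (T' : measurableType d') (m : {measure set T' -> \bar R})
    (f : T' -> R) (c : R) :
  m setT = 1 -> (0 <= c)%R -> measurable_fun setT f -> (forall x, 0 <= f x)%R ->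
  \int[m]_x (f x + c)%:E = \int[m]_x (f x)%:E + c%:E.
Proof.
move=> m1 c0 mf f0; under eq_integral do rewrite EFinD.
rewrite ge0_integralD//.
- by rewrite integral_cst// m1 mule1.
- by move=> x _; rewrite lee_fin.
- exact/measurable_EFinP.
Qed.

Let sumg_mean n : \int[product_pow P n]_t (sumg t)%:E = (n%:R * G)%:E.
Proof.
elim: n => [|n IH].
  rewrite integral_product_pow0; last by apply/measurable_EFinP; exact: measurable_sumg.
  by rewrite /sumg big_ord0 mul0r.
rewrite ge0_integral_product_powS; last 2 first.
- by apply/measurable_EFinP; exact: measurable_sumg.
- by move=> t; rewrite lee_fin.
transitivity (\int[P]_x (g x + n%:R * G)%:E).
  apply: eq_integral => x _; under eq_integral do rewrite sumg_cons EFinD.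
  rewrite ge0_integralD//; last 3 first.
  - by move=> t _; rewrite lee_fin.
  - by move=> t _; rewrite lee_fin.
  - by apply/measurable_EFinP; exact: measurable_sumg.
  rewrite integral_cst// [X in _ * X](@probability_setT _ _ _ (product_pow P n)).
  by rewrite mule1 IH EFinD.
rewrite integral_addc//; first by rewrite GE -EFinD -natr1 mulrDl mul1r addrC.
- exact: probability_setT.
- by rewrite mulr_ge0.
Qed.

(** The factor [n (n - 1)] counts ordered pairs of distinct draws, whose product has mean [G^2] by
    independence. *)
Let sumg_moment2 n : \int[product_pow P n]_t (sumg t ^+ 2)%:E =
  (n%:R * G2 + n%:R * (n%:R - 1) * G ^+ 2)%:E.
Proof.
elim: n => [|n IH].
  rewrite integral_product_pow0; last first.
    by apply/measurable_EFinP; apply: measurable_funX; exact: measurable_sumg.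
  by rewrite /sumg big_ord0 expr0n/= !mul0r addr0.
rewrite ge0_integral_product_powS; last 2 first.
- by apply/measurable_EFinP; apply: measurable_funX; exact: measurable_sumg.
- by move=> t; rewrite lee_fin sqr_ge0.
set M := (_ + _)%R in IH.
transitivity (\int[P]_x ((g x ^+ 2 + (2 * n%:R * G) * g x) + M)%:E).
  apply: eq_integral => x _; under eq_integral => t _.
    rewrite sumg_cons sqrrD -mulr_natl mulrA !EFinD; over.
  have gs t : (0 <= 2 * g x * sumg t)%R by rewrite !mulr_ge0.
  have mgs : measurable_fun setT (fun t : n.-tuple T => (2 * g x * sumg t)%:E).
    apply/measurable_EFinP; apply: measurable_funM; first exact: measurable_cst.
    exact: measurable_sumg.
  rewrite ge0_integralD//; last 4 first.
  - by move=> t _; rewrite -EFinD lee_fin addr_ge0 ?sqr_ge0.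
  - by apply: emeasurable_funD; first exact: measurable_cst.
  - by move=> t _; rewrite lee_fin sqr_ge0.
  - by apply/measurable_EFinP; apply: measurable_funX; exact: measurable_sumg.
  rewrite ge0_integralD//; last 2 first.
  - by move=> t _; rewrite lee_fin sqr_ge0.
  - by move=> t _; rewrite lee_fin.
  rewrite integral_cst// [X in _ * X](@probability_setT _ _ _ (product_pow P n)) mule1.
  rewrite IH; under eq_integral do rewrite EFinM.
  rewrite ge0_integralZl//; last 3 first.
  - by apply/measurable_EFinP; exact: measurable_sumg.
  - by move=> t _; rewrite lee_fin.
  - by rewrite lee_fin mulr_ge0.
  by rewrite sumg_mean -EFinM -!EFinD; congr EFin; ring.
have n0 : (0 <= 2 * n%:R * G)%R by rewrite !mulr_ge0.
have mg2 : measurable_fun setT (fun x => g x ^+ 2)%R by exact: measurable_funX.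
have mng : measurable_fun setT (fun x => 2 * n%:R * G * g x)%R by exact: measurable_funM.
have M0 : (0 <= M)%R.
  by rewrite -lee_fin -IH; apply: integral_ge0 => t _; rewrite lee_fin sqr_ge0.
rewrite integral_addc//; last 3 first.
- exact: probability_setT.
- exact: measurable_realfun.measurable_funD.
- by move=> x; rewrite addr_ge0 ?sqr_ge0 ?mulr_ge0.
under eq_integral do rewrite EFinD.
rewrite ge0_integralD//; last 4 first.
- by move=> x _; rewrite lee_fin sqr_ge0.
- exact/measurable_EFinP.
- by move=> x _; rewrite lee_fin mulr_ge0.
- exact/measurable_EFinP.
under [X in _ + X + _]eq_integral do rewrite EFinM.
rewrite ge0_integralZl//; last 2 first.
- exact/measurable_EFinP.
- by move=> x _; rewrite lee_fin.
rewrite GE G2E -EFinM -!EFinD; congr EFin; rewrite /M -natr1; ring.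
Qed.

(** Integrate [2 G g <= g^2 + G^2], the expanded form of [(g - G)^2 >= 0]. *)
Lemma sqr_integral_le : (fine (\int[P]_x (g x)%:E) ^+ 2)%:E <= \int[P]_x (g x ^+ 2)%:E.
Proof.
rewrite -/G; have H : (2 * G * G)%:E <= (G2 + G ^+ 2)%:E.
  rewrite EFinM -GE -ge0_integralZl//; last 3 first.
  - exact/measurable_EFinP.
  - by move=> x _; rewrite lee_fin.
  - by rewrite lee_fin mulr_ge0.
  rewrite EFinD -G2E -integral_addc//; last 4 first.
  - exact: probability_setT.
  - exact: sqr_ge0.
  - exact: measurable_funX.
  - by move=> x; exact: sqr_ge0.
  apply: ge0_le_integral_nomeas => x; rewrite -?EFinM lee_fin ?mulr_ge0//.
  rewrite -subr_ge0 (_ : _ - _ = (g x - G) ^+ 2)%R ?sqr_ge0//; ring.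
by move: H; rewrite G2E !lee_fin; lra.
Qed.

Lemma variance_empirical_mean n : (0 < n)%N ->
  \int[product_pow P n]_t
    ((fine (\int[P]_x (g x)%:E) - (\sum_(i < n) g (tnth t i)) / n%:R) ^+ 2)%:E <=
  (n%:R^-1)%:E * \int[P]_x (g x ^+ 2)%:E.
Proof.
move=> n0; have nr0 : (0 < n%:R :> R)%R by rewrite ltr0n.
have ms := @measurable_sumg n; rewrite -/G.
set V := (X in X <= _).
have V0 : 0 <= V by apply: integral_ge0 => t _; rewrite lee_fin sqr_ge0.
have mV : measurable_fun [set: n.-tuple T] (fun t => (G - sumg t / n%:R) ^+ 2)%R.
  apply: measurable_funX; apply: measurable_realfun.measurable_funB => //.
  exact: measurable_funM.
(* The cross term [2 G sumg / n] of the square has mean [2 G^2]; moving it to the left keeps every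
   integrand nonnegative. *)
have H : V + (2 * G ^+ 2)%:E =
    (n%:R^-1 * G2 + (1 - n%:R^-1) * G ^+ 2 + G ^+ 2)%:E.
  transitivity (\int[product_pow P n]_t
      ((G - sumg t / n%:R) ^+ 2 + 2 * G / n%:R * sumg t)%:E).
    under [RHS]eq_integral do rewrite EFinD.
    rewrite ge0_integralD//; last 4 first.
    - by move=> t _; rewrite lee_fin sqr_ge0.
    - exact/measurable_EFinP.
    - by move=> t _; rewrite lee_fin !mulr_ge0 ?invr_ge0.
    - by apply/measurable_EFinP; exact: measurable_funM.
    congr (_ + _); under eq_integral do rewrite EFinM.
    rewrite ge0_integralZl//; last 3 first.
    - exact/measurable_EFinP.
    - by move=> t _; rewrite lee_fin.
    - by rewrite lee_fin !mulr_ge0 ?invr_ge0.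
    by rewrite sumg_mean -EFinM; congr EFin; field; rewrite gt_eqF.
  transitivity (\int[product_pow P n]_t (n%:R^-1 ^+ 2 * sumg t ^+ 2 + G ^+ 2)%:E).
    by apply: eq_integral => t _; congr EFin; field; rewrite gt_eqF.
  rewrite integral_addc//; last 4 first.
  - exact: probability_setT.
  - exact: sqr_ge0.
  - by apply: measurable_funM => //; exact: measurable_funX.
  - by move=> t; rewrite mulr_ge0 ?sqr_ge0.
  under eq_integral do rewrite EFinM.
  rewrite ge0_integralZl//; last 2 first.
  - by apply/measurable_EFinP; exact: measurable_funX.
  - by move=> t _; rewrite lee_fin sqr_ge0.
  by rewrite sumg_moment2 -EFinM -EFinD; congr EFin; field; rewrite gt_eqF.
rewrite G2E -EFinM.
have Vf : V \is a fin_num.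
  rewrite ge0_fin_numE//; apply: (@le_lt_trans _ _ (V + (2 * G ^+ 2)%:E)).
    by rewrite leeDl// lee_fin mulr_ge0 ?sqr_ge0.
  by rewrite H ltry.
move: H; rewrite -(fineK Vf) -EFinD lee_fin => -[H].
have : (0 <= n%:R^-1 * G ^+ 2)%R by rewrite mulr_ge0 ?sqr_ge0 ?invr_ge0.
lra.
Qed.

End empirical_mean.

(** * Pointwise bounds for smoothed densities *)

Section smoothed_density_theory.
Context (R : realType) (d : nat) (s : R).
Hypothesis s0 : (0 < s)%R.
Implicit Types (mu : {finite_measure set (rvec R d) -> \bar R}) (x y m : rvec R d).

Let sN0 : s != 0%R. Proof. by rewrite gt_eqF. Qed.

Lemma integral_smoothed_density mu : mu setT = 1 ->
  \int[lebesgue_pow R d]_x (smoothed_density s mu x)%:E = 1.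
Proof.
move=> mu1; rewrite -convolution_gaussianE// /convolution /pushforward preimage_setT.
rewrite -setXTT product_measure1E// -[RHS]mul1e; congr (_ * _); first exact: mu1.
exact: (@probability_setT _ _ _ (gaussian d s)).
Qed.

Lemma smoothed_density_le mu x : mu setT = 1 ->
  (smoothed_density s mu x <= normal_peak s ^+ d)%R.
Proof.
move=> mu1; rewrite -lee_fin EFin_smoothed_density//.
by apply: (le_trans (integral_gauss_density_le sN0 mu x)); rewrite mu1 mule1.
Qed.

(** A zero at [x] would force the strictly positive kernel to vanish [mu]-almost everywhere, so [mu]
    would be null. *)
Lemma smoothed_density_gt0 mu x : mu setT = 1 -> (0 < smoothed_density s mu x)%R.
Proof.
move=> mu1; rewrite lt_neqAle smoothed_density_ge0// andbT eq_sym.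
apply/eqP => q0; have := EFin_smoothed_density sN0 mu x; rewrite q0 => /esym I0.
have mg : measurable_fun setT (fun y => (gauss_density s (subv x y))%:E).
  apply/measurable_EFinP.
  exact: (measurableT_comp (measurable_gauss_density s) (measurable_subvr x)).
have : ae_eq mu setT (fun y => (gauss_density s (subv x y))%:E) (cst 0).
  apply/ae_eq_integral_abs => //.
  rewrite -[RHS]I0; apply: eq_integral => y _.
  by rewrite gee0_abs// lee_fin gauss_density_ge0.
move=> [N [mN N0 sN]].
have : mu setT <= mu N.
  apply: le_measure; rewrite ?inE// => y _; apply: sN => /= /(_ Logic.I).
  by move=> [] /eqP; rewrite gt_eqF// gauss_density_gt0.
by rewrite mu1 N0 lee_fin ler10.
Qed.

(* Jensen's inequality for the exponential, from [1 + v <= exp v] at [v = M - u]. *)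
Lemma smoothed_density_ge (P : probability (rvec R d) R) x (M : R) :
  (0 <= M)%R ->
  \int[P]_y (dotp (subv x y) (subv x y) / (s ^+ 2 *+ 2))%:E <= M%:E ->
  (- ln (smoothed_density s P x / normal_peak s ^+ d) <= M)%R.
Proof.
move=> M0 uM; set C := (normal_peak s ^+ d)%R.
have C0 : (0 < C)%R by rewrite exprn_gt0// normal_peak_gt0.
have q0 := smoothed_density_gt0 x (@probability_setT _ _ _ P).
rewrite lerNl -ler_expR lnK ?posrE ?divr_gt0// ler_pdivlMr// -lee_fin.
rewrite EFin_smoothed_density//.
pose u y := (dotp (subv x y) (subv x y) / (s ^+ 2 *+ 2))%R.
have u0 y : (0 <= u y)%R by rewrite divr_ge0 ?dotp_ge0// mulrn_wge0// sqr_ge0.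
have mu : measurable_fun setT u.
  apply: measurable_funM => //.
  apply: measurable_sum => i; apply: measurable_funM;
    exact: (measurableT_comp (measurable_tnth i) (measurable_subvr x)).
have mg : measurable_fun setT (fun y => (gauss_density s (subv x y))%:E).
  apply/measurable_EFinP.
  exact: (measurableT_comp (measurable_gauss_density s) (measurable_subvr x)).
have gE y : gauss_density s (subv x y) = (C * expR (- u y))%R.
  by rewrite gauss_densityE// -mulNr.
have k0 : (0 <= expR (- M) * C)%R by rewrite mulr_ge0 ?expR_ge0// ltW.
have k1 : (0 <= expR (- M) * C * (1 + M))%R by rewrite mulr_ge0// addr_ge0.
(* The term in [u] is carried on the right-hand side, so that only nonnegative functions are
   integrated. *)
have H : (expR (- M) * C * (1 + M))%:E <=
    \int[P]_y (gauss_density s (subv x y))%:E + (expR (- M) * C * M)%:E.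
  apply: (@le_trans _ _ (\int[P]_y (gauss_density s (subv x y))%:E +
      \int[P]_y (expR (- M) * C * u y)%:E)); last first.
    rewrite leeD2l//; under eq_integral do rewrite EFinM.
    rewrite ge0_integralZl//; last 2 first.
    - exact/measurable_EFinP.
    - by move=> y _; rewrite lee_fin.
    by rewrite (EFinM (expR (- M) * C)); apply: lee_wpmul2l; rewrite ?lee_fin.
  rewrite -ge0_integralD//; last 3 first.
  - by move=> y _; rewrite lee_fin gauss_density_ge0.
  - by move=> y _; rewrite lee_fin mulr_ge0.
  - by apply/measurable_EFinP; exact: measurable_funM.
  rewrite -[leLHS]mule1 -(probability_setT P) -integral_cst//.
  apply: ge0_le_integral_nomeas => y; first by rewrite lee_fin.
  rewrite -EFinD lee_fin gE.
  have -> : expR (- u y) = (expR (- M) * expR (M - u y))%R.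
    by rewrite -expRD addKr.
  have := expR_ge1Dx (M - u y)%R; set e := expR (M - u y) => he.
  rewrite (_ : C * (expR (- M) * e) = expR (- M) * C * e)%R; last by ring.
  by rewrite -mulrDr ler_wpM2l//; lra.
have qE := EFin_smoothed_density sN0 P x.
by move: H; rewrite -qE -EFinD !lee_fin; lra.
Qed.

End smoothed_density_theory.

(** For fixed [x] this is the sample mean of the kernel at [x - y], the form to which the variance
    bound applies. *)
Lemma smoothed_density_empirical (R : realType) d n (s : R)
    (S : n.-tuple (rvec R d)) x : 
  smoothed_density s (empirical S) x =
  ((\sum_(i < n) gauss_density s (subv x (tnth S i))) / n%:R)%R.
Proof.
have mg : measurable_fun setT (fun y => (gauss_density s (subv x y))%:E).
  apply/measurable_EFinP.
  exact: (measurableT_comp (measurable_gauss_density s) (measurable_subvr x)).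
have g0 y : 0 <= (gauss_density s (subv x y))%:E by rewrite lee_fin gauss_density_ge0.
have n0 : (0 <= n%:R^-1 :> R)%R by rewrite invr_ge0.
pose m k : {measure set (rvec R d) -> \bar R} :=
  @dirac _ (rvec R d) (nth [tuple 0%R | _ < d] S k) R.
rewrite /smoothed_density.
have -> : empirical S = mscale (NngNum n0) (msum m n) :> (set _ -> \bar R).
  apply/funext => A; rewrite /empirical /mscale /msum /=; congr (_ * _).
  by apply: eq_bigr => i _; rewrite (tnth_nth [tuple 0%R | _ < d]).
rewrite ge0_integral_mscale// ge0_integral_measure_sum//=.
rewrite mulrC; under eq_bigr => i _.
  rewrite integral_dirac// diracT mul1e -(tnth_nth [tuple 0%R | _ < d]).
  over.
by rewrite sumEFin -EFinM.
Qed.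

Lemma empirical_setT (R : realType) d n (S : n.-tuple (rvec R d)) : (0 < n)%N ->
  empirical S setT = 1.
Proof.
move=> n0; rewrite /empirical; under eq_bigr do rewrite diracT.
rewrite sumEFin sumr_const card_ord -EFinM; congr EFin.
by rewrite mulVf// pnatr_eq0 -lt0n.
Qed.

(** * Second and fourth moments of the norm *)

Section euclidean_moments.
Context (R : realType) (d : nat).
Implicit Types (x y m z : rvec R d).

(** Testing along the i-th axis turns a vector moment generating function into that of one
    coordinate. *)
Lemma dotp_single (i : 'I_d) (t : R) x :
  dotp [tuple (if j == i then t else 0)%R | j < d] x = (t * tnth x i)%R.
Proof.
rewrite /dotp (bigD1 i)//= tnth_mktuple eqxx big1 ?addr0// => j ji.
by rewrite tnth_mktuple (negbTE ji) mul0r.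
Qed.

Lemma sqr_dotp_le x :
  (dotp x x ^+ 2 <= d%:R * \sum_(i < d) tnth x i ^+ 4)%R.
Proof.
rewrite expr2 {1}/dotp mulr_suml.
apply: (@le_trans _ _ (\sum_(i < d) \sum_(j < d)
    (tnth x i ^+ 4 + tnth x j ^+ 4) / 2))%R.
  apply: ler_sum => i _; rewrite mulr_sumr; apply: ler_sum => j _.
  by have := sqr_ge0 (tnth x i ^+ 2 - tnth x j ^+ 2)%R; nra.
under eq_bigr => i _ do rewrite -mulr_suml big_split/= sumr_const card_ord.
rewrite -mulr_suml big_split/= sumr_const card_ord sumrMnl -mulr_natl.
by rewrite le_eqVlt; apply/orP; left; apply/eqP; field.
Qed.

(** The gap is half the square of [(x - m) - 2 (m - y)], coordinatewise. The unequal weights matter: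
    the fourth moment then enters the final bound with coefficient 54, below 64, where the weights 2
    and 2 would give 96. *)
Lemma dotp_subv_le x y m :
  (dotp (subv x y) (subv x y) <=
   3 / 2 * dotp (subv x m) (subv x m) + 3 * dotp (subv y m) (subv y m))%R.
Proof.
rewrite /dotp !mulr_sumr -big_split/=; apply: ler_sum => i _.
rewrite !tnth_subv -!expr2.
by have := sqr_ge0 ((tnth x i - tnth m i) - 2 * (tnth m i - tnth y i))%R; nra.
Qed.

Lemma subgaussian_sqnorm (K : R) (P : probability (rvec R d) R) :
  (0 < K)%R -> subgaussian K P ->
  \int[P]_y (dotp (subv y (mean P)) (subv y (mean P)))%:E <=
  (2 * d%:R * K ^+ 2)%:E.
Proof.
move=> K0 [_ mgfP]; set m := mean P.
have mX i : measurable_fun setT (fun y => tnth y i - tnth m i)%R.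
  apply: measurable_realfun.measurable_funB => //.
  exact: measurable_tnth_rvec.
under eq_integral do rewrite /dotp -sumEFin.
rewrite ge0_integral_sum//; last 2 first.
- move=> i; apply/measurable_EFinP; under eq_fun do rewrite tnth_subv.
  exact: measurable_funM.
- by move=> i y _; rewrite lee_fin -expr2 sqr_ge0.
apply: (@le_trans _ _ (\sum_(i < d) (2 * K ^+ 2)%:E)).
  apply: lee_sum => i _.
  under eq_integral do rewrite tnth_subv -expr2.
  apply: subgaussian_moment2 => // t.
  have := mgfP [tuple (if j == i then t else 0)%R | j < d].
  rewrite dotp_single tnth_mktuple eqxx.
  under eq_integral do rewrite dotp_single tnth_subv.
  by rewrite -expr2.
rewrite sumEFin sumr_const card_ord lee_fin -mulr_natl.
by rewrite le_eqVlt; apply/orP; left; apply/eqP; ring.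
Qed.

(** A Gaussian coordinate satisfies the subgaussian bound with constant [a], so the general estimate
    [12 a^4] stands in for the exact moment [3 a^4]. *)
Lemma gaussian_norm4 (a : R) : (0 < a)%R ->
  \int[gaussian d a]_z (dotp z z ^+ 2)%:E <= (12 * d%:R ^+ 2 * a ^+ 4)%:E.
Proof.
move=> a0.
have mX i : measurable_fun [set: rvec R d] (fun z => tnth z i ^+ 4 : R)%R.
  by apply: measurable_funX; exact: measurable_tnth_rvec.
apply: (@le_trans _ _ (\int[gaussian d a]_z
    (d%:R%:E * \sum_(i < d) (tnth z i ^+ 4)%:E))).
  apply: ge0_le_integral_nomeas => z; first by rewrite lee_fin sqr_ge0.
  by rewrite sumEFin -EFinM lee_fin sqr_dotp_le.
rewrite ge0_integralZl//; last 2 first.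
- by apply: emeasurable_sum => i; apply/measurable_EFinP.
- by move=> z _; apply: sume_ge0 => i _; rewrite lee_fin exprn_even_ge0.
rewrite ge0_integral_sum//; last 2 first.
- by move=> i; apply/measurable_EFinP.
- by move=> i z _; rewrite lee_fin exprn_even_ge0.
apply: (@le_trans _ _ (d%:R%:E * \sum_(i < d) (12 * a ^+ 4)%:E)).
  apply: lee_wpmul2l; first by rewrite lee_fin.
  apply: lee_sum => i _; apply: (subgaussian_moment4 (P := gaussian d a)) => //.
    exact: measurable_tnth_rvec.
  move=> t; under eq_integral do rewrite -dotp_single.
  by rewrite gaussian_mgf// dotp_single tnth_mktuple eqxx -expr2.
rewrite sumEFin sumr_const card_ord -EFinM lee_fin -mulr_natl.
by rewrite le_eqVlt; apply/orP; left; apply/eqP; ring.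
Qed.

End euclidean_moments.

(** * The logarithmic weight *)

Section log_weight.
Context (R : realType) (d : nat) (s K : R) (P : probability (rvec R d) R).
Hypotheses (s0 : (0 < s)%R) (K0 : (0 < K)%R) (sgP : subgaussian K P).
Local Notation m := (mean P).

(** Bounds the [P]-mean of [|x - y|^2 / (2 s^2)]; [6 d K^2] is 3 times the second moment bound
    [2 d K^2]. *)
Definition log_bound (x : rvec R d) : R :=
  ((3 / 2 * dotp (subv x m) (subv x m) + 6 * d%:R * K ^+ 2) / (s ^+ 2 *+ 2))%R.

Definition log_weight (x : rvec R d) : R := Num.max 1%R (log_bound x).

Lemma log_bound_ge0 x : (0 <= log_bound x)%R.
Proof.
rewrite divr_ge0 ?mulrn_wge0 ?sqr_ge0// addr_ge0//.
  by rewrite mulr_ge0// dotp_ge0.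
by rewrite mulr_ge0 ?sqr_ge0// mulr_ge0.
Qed.

Lemma measurable_log_weight : measurable_fun setT log_weight.
Proof.
apply: measurable_maxr => //; apply: measurable_funM => //.
apply: measurable_realfun.measurable_funD => //; apply: measurable_funM => //.
exact: measurable_dotp_subv.
Qed.

Lemma log_weight_ge1 x : (1 <= log_weight x)%R.
Proof. by rewrite le_max lexx. Qed.

Lemma ln_smoothed_density_le x :
  (- ln (smoothed_density s P x / normal_peak s ^+ d) <= log_weight x)%R.
Proof.
rewrite le_max; apply/orP; right.
apply: smoothed_density_ge => //; first exact: log_bound_ge0.
have i0 : (0 <= (s ^+ 2 *+ 2)^-1)%R by rewrite invr_ge0 mulrn_wge0// sqr_ge0.
pose c := (3 / 2 * dotp (subv x m) (subv x m))%R.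
have c0 : (0 <= c)%R by rewrite mulr_ge0// dotp_ge0.
have md := measurable_dotp_subv m.
apply: (@le_trans _ _ (\int[P]_y
    ((s ^+ 2 *+ 2)^-1%:E * (c%:E + 3%:E * (dotp (subv y m) (subv y m))%:E)))).
  apply: ge0_le_integral_nomeas => y.
    by rewrite lee_fin mulr_ge0// dotp_ge0.
  by rewrite !(=^~ EFinM, =^~ EFinD) lee_fin mulrC ler_wpM2l// dotp_subv_le.
have p0 y : 0 <= (dotp (subv y m) (subv y m))%:E by rewrite lee_fin dotp_ge0.
have mp : measurable_fun setT (fun y => (dotp (subv y m) (subv y m))%:E).
  exact/measurable_EFinP.
have mp3 : measurable_fun setT (fun y => 3%:E * (dotp (subv y m) (subv y m))%:E).
  exact: measurable_funeM.
have p30 y : 0 <= 3%:E * (dotp (subv y m) (subv y m))%:E.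
  by rewrite mule_ge0// lee_fin.
rewrite ge0_integralZl//; last 2 first.
- by apply: emeasurable_funD => //; exact: measurable_cst.
- by move=> y _; rewrite adde_ge0// lee_fin.
rewrite ge0_integralD//.
rewrite integral_cst// [X in c%:E * X](@probability_setT _ _ _ P) mule1.
rewrite ge0_integralZl//.
rewrite /log_bound [X in _ <= X%:E]mulrC [leRHS]EFinM.
apply: lee_wpmul2l; first by rewrite lee_fin.
rewrite [leRHS]EFinD leeD2l//.
rewrite (_ : 6 * d%:R * K ^+ 2 = 3 * (2 * d%:R * K ^+ 2))%R; last by ring.
rewrite [leRHS]EFinM; apply: lee_wpmul2l; first by rewrite lee_fin.
exact: subgaussian_sqnorm.
Qed.

Lemma gauss_density_log_weight (a : R) : (0 < a)%R ->
  \int[lebesgue_pow R d]_x (gauss_density a (subv x m) * log_weight x ^+ 2)%:E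
  <= (1 + (27 / 2 * d%:R ^+ 2 * a ^+ 4 + 18 * d%:R ^+ 2 * K ^+ 4) / s ^+ 4)%:E.
Proof.
move=> a0; have mw := measurable_log_weight.
rewrite -(ge0_integral_lebesgue_pow_translation m); last 2 first.
- apply/measurable_EFinP; apply: measurable_funM.
    exact: (measurableT_comp (measurable_gauss_density a) (measurable_subvl m)).
  exact: measurable_funX.
- by move=> x; rewrite lee_fin mulr_ge0 ?gauss_density_ge0 ?sqr_ge0.
rewrite [leLHS](_ : _ = \int[gaussian d a]_z (log_weight (addv m z) ^+ 2)%:E); last first.
  rewrite ge0_integral_gaussian.
  - by apply: eq_integral => z _; rewrite addvK mulrC EFinM.
  - apply/measurable_EFinP; apply: measurable_funX.
    exact: (measurableT_comp mw (measurable_addvr m)).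
  - by move=> z; rewrite lee_fin sqr_ge0.
(* The 1 comes from [max(1, l)^2 <= 1 + l^2]. The coefficients 9/8 and 18 come from
   [(p + q)^2 <= 2 p^2 + 2 q^2] with [p = 3 u / 2] and [q = 6 v], divided by [4 s^4]. *)
pose c := (9 / 8 / s ^+ 4)%R; pose e := (1 + 18 * d%:R ^+ 2 * K ^+ 4 / s ^+ 4)%R.
have c0 : (0 <= c)%R by rewrite divr_ge0// exprn_even_ge0.
have e0 : (0 <= e)%R.
  rewrite addr_ge0// divr_ge0 ?exprn_ge0 ?(ltW s0)//.
  by rewrite mulr_ge0 ?exprn_ge0 ?(ltW K0)// mulr_ge0 ?sqr_ge0.
have md : measurable_fun setT (fun z : rvec R d => (dotp z z ^+ 2)%:E).
  apply/measurable_EFinP; apply: measurable_funX; apply: measurable_sum => i.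
  by apply: measurable_funM; exact: measurable_tnth_rvec.
have d20 z : 0 <= (dotp z z ^+ 2 : R)%:E by rewrite lee_fin sqr_ge0.
apply: (@le_trans _ _ (\int[gaussian d a]_z (c%:E * (dotp z z ^+ 2)%:E + e%:E))).
  apply: ge0_le_integral_nomeas => z; first by rewrite lee_fin sqr_ge0.
  rewrite -EFinM -EFinD lee_fin.
  have lb0 := log_bound_ge0 (addv m z).
  apply: (@le_trans _ _ (1 + log_bound (addv m z) ^+ 2))%R.
    rewrite /log_weight maxEle; case: ifP => _; last by rewrite expr1n lerDl sqr_ge0.
    by rewrite lerDr.
  rewrite /log_bound addvK /e addrCA lerD2l /c.
  set u := dotp z z; set v := (d%:R * K ^+ 2)%R.
  have -> : (6 * d%:R * K ^+ 2 = 6 * v)%R by rewrite /v; ring.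
  have -> : (18 * d%:R ^+ 2 * K ^+ 4 = 18 * v ^+ 2)%R by rewrite /v; ring.
  rewrite -subr_ge0 (_ : _ - _ = (3 / 2 * u - 6 * v) ^+ 2 / 4 / s ^+ 4)%R.
    by rewrite !divr_ge0 ?sqr_ge0 ?exprn_even_ge0.
  by field; rewrite gt_eqF.
rewrite ge0_integralD//; last 2 first.
- by move=> z _; rewrite mule_ge0.
- exact: measurable_funeM.
rewrite integral_cst// [X in _ * X](@probability_setT _ _ _ (gaussian d a)) mule1.
rewrite ge0_integralZl//.
apply: (@le_trans _ _ (c%:E * (12 * d%:R ^+ 2 * a ^+ 4)%:E + e%:E)).
  by rewrite leeD2r//; apply: lee_wpmul2l; [rewrite lee_fin|exact: gaussian_norm4].
rewrite -EFinM -EFinD lee_fin le_eqVlt; apply/orP; left; apply/eqP.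
by rewrite /c /e; field; rewrite gt_eqF.
Qed.

End log_weight.

(** * Matching the explicit constant *)

(** With [t = s / sqrt 2], [b^2 - K^2 = K^2 + 4 K t + t^2 >= (K + t)^2]. One factor [K + t] of
    [a^2 = 2 (K + t)^2] therefore cancels and [sqrt 2 (K + t) / s] remains. *)
Lemma chi_square_const (R : realType) (s K : R) :
  (0 < s)%R -> (0 < K)%R ->
  let a := (Num.sqrt 2 * (K + s / Num.sqrt 2))%R in
  exists b : R, [/\ (K < b)%R, (b ^+ 2 = a ^+ 2 - s ^+ 2 / 2)%R &
    (0 <= a ^+ 2 / (Num.sqrt 2 * s * Num.sqrt (b ^+ 2 - K ^+ 2)) <=
     ((Num.sqrt 2)^-1 + K / s) * expR (3 / 8))%R].
Proof.
move=> s0 K0 a.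
have w0 : (0 < Num.sqrt 2 :> R)%R by rewrite sqrtr_gt0.
have w2 : (Num.sqrt 2 ^+ 2 = 2 :> R)%R by rewrite sqr_sqrtr.
set w := Num.sqrt 2 in a w0 w2 *.
pose t := (s / w)%R; have t0 : (0 < t)%R by rewrite divr_gt0.
have sE : (s = w * t)%R by rewrite /t; field; rewrite gt_eqF.
have aE : (a ^+ 2 = 2 * (K + t) ^+ 2)%R by rewrite /a exprMn w2.
have s2 : (s ^+ 2 = 2 * t ^+ 2)%R by rewrite sE exprMn w2.
have kt : (0 < K * t)%R by rewrite mulr_gt0.
have B0 : (0 <= a ^+ 2 - s ^+ 2 / 2)%R by rewrite aE s2; nra.
exists (Num.sqrt (a ^+ 2 - s ^+ 2 / 2))%R; split.
- rewrite -[ltLHS]gtr0_norm// -sqrtr_sqr ltr_sqrt; rewrite aE s2; nra.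
- by rewrite sqr_sqrtr.
rewrite sqr_sqrtr//; set c := Num.sqrt _.
have Kt : (0 < K + t)%R by rewrite addr_gt0.
have cK : (K + t <= c)%R.
  rewrite -[leLHS]gtr0_norm// -sqrtr_sqr ler_wsqrtr// aE s2; nra.
have c0 : (0 < c)%R by exact: lt_le_trans cK.
rewrite divr_ge0 ?sqr_ge0//= ?mulr_ge0 ?(ltW w0) ?(ltW s0) ?(ltW c0)//.
rewrite (_ : w^-1 + K / s = (K + t) / s)%R; last first.
  by rewrite sE; field; rewrite !gt_eqF.
apply: (@le_trans _ _ ((K + t) / s * w))%R; last first.
  by rewrite ler_wpM2l ?sqrt2_le_expR// divr_ge0 ?ltW.
rewrite ler_pdivrMr ?mulr_gt0// aE.
rewrite (_ : (K + t) / s * w * (w * s * c) = (K + t) * c * w ^+ 2)%R; last first.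
  by field; rewrite gt_eqF.
by rewrite w2; nra.
Qed.

(** Since [a^4 = 4 K'^4], the first moment term has coefficient 54; the summand 1 adds at most 4,
    because [s <= sqrt 2 K'] and [d >= 1]. Then 58 is below 64, and 18 is below 128. *)
Lemma entropy_const_ge (R : realType) (s K : R) (d : nat) :
  (0 < s)%R -> (0 < K)%R -> (0 < d)%N ->
  forall K' : R, K' = (K + s / Num.sqrt 2)%R ->
  (1 + (27 / 2 * d%:R ^+ 2 * (Num.sqrt 2 * K') ^+ 4 + 18 * d%:R ^+ 2 * K ^+ 4) / s ^+ 4
  <= 64 * (2 * d%:R ^+ 2 * K ^+ 4 + d%:R * (d%:R + 2) * K' ^+ 4) / s ^+ 4)%R.
Proof.
move=> s0 K0 d0 K' K'E.
have w0 : (0 < Num.sqrt 2 :> R)%R by rewrite sqrtr_gt0.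
have w2 : (Num.sqrt 2 ^+ 2 = 2 :> R)%R by rewrite sqr_sqrtr.
have w4 : (Num.sqrt 2 ^+ 4 = 4 :> R)%R by rewrite (exprM _ 2 2) w2 expr2; ring.
have d1 : (1 <= d%:R :> R)%R by rewrite ler1n.
have s4 : (0 < s ^+ 4)%R by rewrite exprn_gt0.
have K'0 : (0 <= K')%R by rewrite K'E addr_ge0 ?divr_ge0 ?ltW.
have K4 : (0 <= K ^+ 4)%R by rewrite exprn_ge0 ?ltW.
have sK' : (s ^+ 4 <= 4 * K' ^+ 4)%R.
  rewrite -w4 -exprMn lerXn2r ?nnegrE ?(ltW s0)//.
    by rewrite mulr_ge0 ?(ltW w0).
  rewrite K'E mulrDr mulrCA divff ?gt_eqF// mulr1 lerDr.
  by rewrite mulr_ge0 ?ltW.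
have K'4 : (0 <= K' ^+ 4)%R.
  by rewrite exprn_ge0.
rewrite -[X in (X + _)%R](divff (_ : s ^+ 4 != 0)%R) ?gt_eqF// -mulrDl.
rewrite ler_pM2r ?invr_gt0// exprMn w4.
have d2 : (1 <= d%:R ^+ 2 :> R)%R by rewrite -[leLHS](expr1n _ 2) lerXn2r ?nnegrE.
set D := (d%:R ^+ 2)%R in d2 *.
have -> : (d%:R * (d%:R + 2) = D + 2 * d%:R :> R)%R by rewrite /D; ring.
have h1 : (K' ^+ 4 <= D * K' ^+ 4)%R by rewrite ler_peMl.
have h2 : (0 <= D * K ^+ 4)%R by rewrite mulr_ge0// (le_trans _ d2).
have h3 : (0 <= d%:R * K' ^+ 4)%R by rewrite mulr_ge0.
nra.
Qed.

(** * The expected entropy gap *)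

Section entropy_estimation.
Context (R : realType) (d n : nat) (s K : R) (P : probability (rvec R d) R).
Hypotheses (s0 : (0 < s)%R) (K0 : (0 < K)%R) (sgP : subgaussian K P).
Hypotheses (d0 : (0 < d)%N) (n0 : (0 < n)%N).

Local Notation L := (lebesgue_pow R d).
Local Notation m := (mean P).
Local Notation K' := (K + s / Num.sqrt 2)%R.
Local Notation a := (Num.sqrt 2 * K')%R.
Let f x := gauss_density a (subv x m).
Let q := smoothed_density s P.
Let r (S : n.-tuple (rvec R d)) := smoothed_density s (empirical S).
Let W := log_weight s K P.
Let V := ((((Num.sqrt 2)^-1 + K / s) * expR (3 / 8)) ^+ d)%R.
Let Z := (64 * (2 * d%:R ^+ 2 * K ^+ 4 + d%:R * (d%:R + 2) * K' ^+ 4) / s ^+ 4)%R.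

Let sN0 : s != 0%R. Proof. by rewrite gt_eqF. Qed.

Let sqrt2_gt0 : (0 < Num.sqrt 2 :> R)%R. Proof. by rewrite sqrtr_gt0. Qed.

Let K'0 : (0 < K')%R. Proof. by rewrite addr_gt0// divr_gt0. Qed.

Let a0 : (0 < a)%R. Proof. by rewrite mulr_gt0. Qed.

Let f0 x : (0 < f x)%R. Proof. by rewrite gauss_density_gt0// gt_eqF. Qed.

Let V0 : (0 < V)%R.
Proof.
by rewrite exprn_gt0// mulr_gt0 ?expR_gt0// addr_gt0 ?invr_gt0// divr_gt0.
Qed.

Let mf : measurable_fun setT f.
Proof. exact: (measurableT_comp (measurable_gauss_density a) (measurable_subvl m)). Qed.

Let mfV : measurable_fun setT (fun x => (f x)^-1)%R.
Proof. exact: measurable_inv_gt0. Qed.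

Let mq : measurable_fun setT q. Proof. exact: measurable_smoothed_density. Qed.

Let mr S : measurable_fun setT (r S).
Proof. exact: measurable_smoothed_density. Qed.

Let mW : measurable_fun setT W. Proof. exact: measurable_log_weight. Qed.

Let W0 x : (0 <= W x)%R. Proof. by rewrite (le_trans _ (log_weight_ge1 s K P x)). Qed.

Let g0 (x y : rvec R d) : (0 <= gauss_density s (subv x y))%R.
Proof. exact: gauss_density_ge0. Qed.

Let mg (x : rvec R d) : measurable_fun setT (fun y => gauss_density s (subv x y)).
Proof.
exact: (measurableT_comp (measurable_gauss_density s) (measurable_subvr x)).
Qed.

Let mgE (x : rvec R d) :
  measurable_fun setT (fun y => (gauss_density s (subv x y) ^+ 2)%:E).
Proof. by apply/measurable_EFinP; apply: measurable_funX; exact: mg. Qed.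

Let gB (x y : rvec R d) : (gauss_density s (subv x y) <= normal_peak s ^+ d)%R.
Proof. exact: gauss_density_le. Qed.

Let chi2 : \int[L]_x
  ((\int[P]_y (gauss_density s (subv x y) ^+ 2)%:E) * ((f x)^-1)%:E) <= V%:E.
Proof.
have [b [Kb bE /andP[c0 cV]]] := chi_square_const s0 K0.
apply: (@le_trans _ _ ((a ^+ 2 / (Num.sqrt 2 * s * Num.sqrt (b ^+ 2 - K ^+ 2))) ^+ d)%:E);
  last by rewrite lee_fin lerXn2r// nnegrE// (le_trans c0).
apply: le_trans (chi_square_bound K0 Kb s0 a0 bE sgP).
rewrite (fubini_tonelli
  (fun p => (gauss_density s (subv p.2 p.1) ^+ 2 / f p.2)%:E)); last 2 first.
- apply/measurable_EFinP; apply: measurable_funM; last first.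
    exact: (measurableT_comp mfV measurable_snd).
  apply: measurable_funX.
  have ms : measurable_fun [set: rvec R d * rvec R d] (fun p => (p.2, p.1)).
    by apply: measurable_fun_pair; [exact: measurable_snd|exact: measurable_fst].
  exact: (measurableT_comp (@measurable_gauss_density_subv R d s) ms).
- by move=> p; rewrite lee_fin divr_ge0 ?sqr_ge0// ltW.
rewrite le_eqVlt; apply/orP; left; apply/eqP; apply: eq_integral => x _.
rewrite -ge0_integralZr//.
- by move=> y _; rewrite lee_fin sqr_ge0.
- by rewrite lee_fin invr_ge0 ltW.
Qed.

Let weight_le : \int[L]_x (f x * W x ^+ 2)%:E <= Z%:E.
Proof.
apply: (le_trans (gauss_density_log_weight P s0 K0 a0)).
by rewrite lee_fin; exact: entropy_const_ge.
Qed.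

(* Cauchy-Schwarz in the form of AM-GM with a free parameter [t], which is
   optimised at the very end. *)
Let weighted_le (t : R) (h : rvec R d -> R) : (0 < t)%R -> measurable_fun setT h ->
  \int[L]_x (`|h x| * W x)%:E <=
  (t / 2)%:E * \int[L]_x (h x ^+ 2 / f x)%:E + ((t *+ 2)^-1 * Z)%:E.
Proof.
move=> t0 mh.
have t20 : (0 <= t / 2)%R by rewrite divr_ge0// ltW.
have ti0 : (0 <= (t *+ 2)^-1)%R by rewrite invr_ge0 mulrn_wge0// ltW.
have hf0 x : (0 <= h x ^+ 2 / f x)%R by rewrite divr_ge0 ?sqr_ge0// ltW.
have fW0 x : (0 <= f x * W x ^+ 2)%R by rewrite mulr_ge0 ?sqr_ge0// ltW.
have mhf : measurable_fun setT (fun x => (h x ^+ 2 / f x)%:E).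
  by apply/measurable_EFinP; apply: measurable_funM => //; exact: measurable_funX.
have mfW : measurable_fun setT (fun x => (f x * W x ^+ 2)%:E).
  by apply/measurable_EFinP; apply: measurable_funM => //; exact: measurable_funX.
apply: (@le_trans _ _ (\int[L]_x ((t / 2)%:E * (h x ^+ 2 / f x)%:E +
    ((t *+ 2)^-1)%:E * (f x * W x ^+ 2)%:E))).
  apply: ge0_le_integral_nomeas => x; first by rewrite lee_fin mulr_ge0.
  rewrite !(=^~ EFinM, =^~ EFinD) lee_fin -subr_ge0.
  rewrite -(real_normK (num_real (h x))).
  rewrite (_ : _ - _ = (t * `|h x| - f x * W x) ^+ 2 / (t *+ 2 * f x))%R.
    by rewrite divr_ge0 ?sqr_ge0// mulr_ge0 ?mulrn_wge0// ltW.
  by field; rewrite !gt_eqF.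
rewrite ge0_integralD//; last 4 first.
- by move=> x _; rewrite mule_ge0 ?lee_fin.
- exact: measurable_funeM.
- by move=> x _; rewrite mule_ge0 ?lee_fin.
- exact: measurable_funeM.
rewrite ge0_integralZl//; last by move=> x _; rewrite lee_fin.
rewrite ge0_integralZl//; last by move=> x _; rewrite lee_fin.
by rewrite leeD2l// EFinM; apply: lee_wpmul2l; rewrite ?lee_fin.
Qed.

Let entropy_dist_empirical_le S :
  `| differential_entropy (convolution P (gaussian d s))
     - differential_entropy (convolution (empirical S) (gaussian d s)) | <=
  \int[L]_x (`|q x - r S x| * W x)%:E.
Proof.
have P1 : P setT = 1 by exact: probability_setT.
have S1 : empirical S setT = 1 :> \bar R by exact: empirical_setT.
rewrite !convolution_gaussian_entropy//.
have p0 : (0 < normal_peak s)%R by exact: normal_peak_gt0.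
apply: (@entropy_dist_le _ _ _ L (normal_peak s ^+ d)).
- exact: exprn_gt0.
- exact: mq.
- exact: mr.
- exact: mW.
- by move=> x; rewrite smoothed_density_gt0// smoothed_density_le.
- by move=> x; rewrite smoothed_density_gt0// smoothed_density_le.
- exact: log_weight_ge1.
- by move=> x; exact: ln_smoothed_density_le.
- exact: integral_smoothed_density.
- exact: integral_smoothed_density.
(* Finiteness of this integral follows from the weighted Cauchy-Schwarz bound with [h = q] and
   [t = 1]; [q^2] is at most the [P]-mean of the squared kernel, which the chi-square bound
   controls. *)
have -> : \int[L]_x (smoothed_density s P x * log_weight s K P x)%:E =
    \int[L]_x (`|q x| * W x)%:E.
  by apply: eq_integral => x _; rewrite ger0_norm// smoothed_density_ge0.
apply: le_lt_trans (weighted_le ltr01 mq) _.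
apply: lte_add_pinfty; last exact: ltry.
apply: lte_mul_pinfty; rewrite ?lee_fin//.
apply: le_lt_trans (ltry V); apply: le_trans chi2.
apply: ge0_le_integral_nomeas => x.
  by rewrite lee_fin divr_ge0 ?sqr_ge0// ltW.
rewrite EFinM lee_wpmul2r ?lee_fin ?invr_ge0 ?(ltW (f0 x))//.
exact: (sqr_integral_le P (mg x) (g0 x) (gB x)).
Qed.

Let X S := \int[L]_x ((q x - r S x) ^+ 2 / f x)%:E.

Let joint_ge0 (p : n.-tuple (rvec R d) * rvec R d) :
  0 <= ((q p.2 - r p.1 p.2) ^+ 2 / f p.2)%:E.
Proof. by rewrite lee_fin divr_ge0 ?sqr_ge0// ltW. Qed.

Let measurable_r :
  measurable_fun [set: n.-tuple (rvec R d) * rvec R d] (fun p => r p.1 p.2).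
Proof.
rewrite /r; under eq_fun do rewrite smoothed_density_empirical.
apply: measurable_funM => //; apply: measurable_sum => i.
have ms : measurable_fun [set: n.-tuple (rvec R d) * rvec R d]
    (fun p => (p.2, tnth p.1 i)).
  apply: measurable_fun_pair; first exact: measurable_snd.
  exact: (measurableT_comp (measurable_tnth i) measurable_fst).
exact: (measurableT_comp (@measurable_gauss_density_subv R d s) ms).
Qed.

Let measurable_joint : measurable_fun [set: n.-tuple (rvec R d) * rvec R d]
  (fun p => ((q p.2 - r p.1 p.2) ^+ 2 / f p.2)%:E).
Proof.
apply/measurable_EFinP; apply: measurable_funM; last first.
  exact: (measurableT_comp mfV measurable_snd).
apply: measurable_funX; apply: measurable_realfun.measurable_funB.
  exact: (measurableT_comp mq measurable_snd).
exact: measurable_r.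
Qed.

Let integral_X_le : \int[product_pow P n]_S X S <= (V / n%:R)%:E.
Proof.
rewrite /X (fubini_tonelli (fun p => ((q p.2 - r p.1 p.2) ^+ 2 / f p.2)%:E))//=.
apply: (@le_trans _ _ (\int[L]_x ((n%:R^-1)%:E *
    ((\int[P]_y (gauss_density s (subv x y) ^+ 2)%:E) * ((f x)^-1)%:E)))).
  apply: ge0_le_integral_nomeas => x.
    by apply: integral_ge0 => S _; exact: (joint_ge0 (S, x)).
  under eq_integral do rewrite EFinM.
  rewrite ge0_integralZr//; last 3 first.
  - apply/measurable_EFinP; apply: measurable_funX.
    apply: measurable_realfun.measurable_funB => //.
    exact: (measurableT_comp measurable_r (measurable_pair2 x)).
  - by move=> S _; rewrite lee_fin sqr_ge0.
  - by rewrite lee_fin invr_ge0 ltW.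
  rewrite muleA lee_wpmul2r ?lee_fin ?invr_ge0 ?(ltW (f0 x))//.
  under eq_integral do rewrite /r smoothed_density_empirical.
  exact: (variance_empirical_mean P (mg x) (g0 x) (gB x)).
rewrite ge0_integralZl//; last 2 first.
- apply: emeasurable_funM; last exact/measurable_EFinP.
  apply: (@measurable_fun_fubini_tonelli_F _ _ _ _ _ P
    (fun p => (gauss_density s (subv p.1 p.2) ^+ 2)%:E)).
    apply/measurable_EFinP; apply: measurable_funX.
    exact: measurable_gauss_density_subv.
  by move=> p; rewrite lee_fin sqr_ge0.
- move=> x _; rewrite mule_ge0 ?lee_fin ?invr_ge0 ?(ltW (f0 x))//.
  by apply: integral_ge0 => y _; rewrite lee_fin sqr_ge0.
by rewrite mulrC EFinM; apply: lee_wpmul2l; rewrite ?lee_fin ?invr_ge0.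
Qed.

Lemma expected_entropy_dist_le :
  \int[product_pow P n]_S
    `| differential_entropy (convolution P (gaussian d s))
       - differential_entropy (convolution (empirical S) (gaussian d s)) | <=
  (entropy_const s d K / Num.sqrt n%:R)%:E.
Proof.
have X0 S : 0 <= X S by apply: integral_ge0 => x _; exact: (joint_ge0 (S, x)).
have mX : measurable_fun setT X.
  exact: (measurable_fun_fubini_tonelli_F _ measurable_joint joint_ge0).
have Z0 : (0 < Z)%R.
  rewrite divr_gt0 ?exprn_gt0// mulr_gt0// ltr_wpDl//.
    by rewrite mulr_ge0 ?exprn_ge0 ?(ltW K0)// mulr_ge0 ?sqr_ge0.
  by rewrite mulr_gt0 ?exprn_gt0// mulr_gt0 ?ltr0n// ltr_wpDl.
pose c := Num.sqrt (Z * V); have c0 : (0 < c)%R by rewrite sqrtr_gt0 mulr_gt0.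
have c2 : (c ^+ 2 = Z * V)%R by rewrite sqr_sqrtr// mulr_ge0 ?ltW.
pose v := Num.sqrt (n%:R : R); have v0 : (0 < v)%R by rewrite sqrtr_gt0 ltr0n.
have v2 : (v ^+ 2 = n%:R)%R by rewrite sqr_sqrtr.
(* The minimiser [sqrt (n Z / V)] of [t V / (2 n) + Z / (2 t)]; both terms then equal
   [c / (2 v)]. *)
pose t := (c * v / V)%R; have t0 : (0 < t)%R by rewrite divr_gt0 ?mulr_gt0.
have t20 : (0 <= t / 2)%R by rewrite divr_ge0// ltW.
have tZ0 : (0 <= (t *+ 2)^-1 * Z)%R.
  by rewrite mulr_ge0 ?invr_ge0 ?mulrn_wge0 ?ltW.
apply: (@le_trans _ _ (\int[product_pow P n]_S
    ((t / 2)%:E * X S + ((t *+ 2)^-1 * Z)%:E))).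
  (* Measurability of the entropy gap in the sample is never established; monotonicity holds because
     the integral is a supremum over simple functions. *)
  apply: ge0_le_integral_nomeas => S //.
  apply: (le_trans (entropy_dist_empirical_le S)).
  by apply: weighted_le => //; exact: measurable_realfun.measurable_funB.
rewrite ge0_integralD//; last 2 first.
- by move=> S _; rewrite mule_ge0.
- exact: measurable_funeM.
rewrite integral_cst// [X in _ * X](@probability_setT _ _ _ (product_pow P n)) mule1.
rewrite ge0_integralZl//.
apply: (@le_trans _ _ ((t / 2)%:E * (V / n%:R)%:E + ((t *+ 2)^-1 * Z)%:E)).
  by rewrite leeD2r//; apply: lee_wpmul2l; rewrite ?lee_fin.
rewrite -EFinM -EFinD lee_fin.
rewrite (_ : entropy_const s d K = c)//.
rewrite le_eqVlt; apply/orP; left; apply/eqP.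
have -> : Z = (c ^+ 2 / V)%R by rewrite c2 mulfK// gt_eqF.
by rewrite -/v -v2 /t; field; rewrite !gt_eqF.
Qed.

End entropy_estimation.

(** * Growth of the constant with the dimension *)

(** The polynomial factor is absorbed into the base: [d (d + 2) <= 3 d^2], and [d^2 <= 4^d] since
    [d <= 2^d]. The square root then leaves the base [sqrt (4 rho)], which depends on [s] and [K]
    through [rho]. *)
Lemma entropy_const_bigO (R : realType) (s K : R) : (0 < s)%R -> (0 < K)%R ->
  exists2 c : R, (0 < c)%R &
    (fun d : nat => entropy_const s d K) =O_\oo (fun d : nat => (c ^+ d)%R).
Proof.
move=> s0 K0; have w0 : (0 < Num.sqrt 2 :> R)%R by rewrite sqrtr_gt0.
pose rho := (((Num.sqrt 2)^-1 + K / s) * expR (3 / 8))%R.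
have rho0 : (0 < rho)%R.
  by rewrite mulr_gt0 ?expR_gt0// addr_gt0 ?invr_gt0// divr_gt0.
have K'0 : (0 < K + s / Num.sqrt 2)%R by rewrite addr_gt0// divr_gt0.
pose A := (64 * (2 * K ^+ 4 + 3 * (K + s / Num.sqrt 2) ^+ 4) / s ^+ 4)%R.
have A0 : (0 < A)%R.
  rewrite divr_gt0 ?exprn_gt0// mulr_gt0// addr_gt0// mulr_gt0// exprn_gt0//.
exists (Num.sqrt (4 * rho))%R; first by rewrite sqrtr_gt0 mulr_gt0.
apply/eqO_exP; exists (Num.sqrt A); first by rewrite sqrtr_gt0.
near=> d; rewrite /= [leLHS]ger0_norm ?sqrtr_ge0//.
rewrite [X in (_ <= _ * X)%R]ger0_norm ?exprn_ge0 ?sqrtr_ge0//.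
have -> : (Num.sqrt (4 * rho) ^+ d = Num.sqrt ((4 * rho) ^+ d))%R.
  have r4 : (0 <= 4 * rho)%R by rewrite mulr_ge0// ltW.
  rewrite -[in RHS](sqr_sqrtr r4).
  by rewrite exprAC sqrtr_sqr ger0_norm// exprn_ge0 ?sqrtr_ge0.
rewrite /entropy_const -/rho -sqrtrM ?(ltW A0)// ler_wsqrtr//.
rewrite [((4 * rho) ^+ d)%R]exprMn [leRHS]mulrA.
rewrite ler_pM2r ?exprn_gt0// /A [leRHS]mulrAC ler_pM2r ?invr_gt0 ?exprn_gt0//.
have d2 : (d%:R ^+ 2 <= 4 ^+ d :> R)%R.
  by rewrite -!natrX ler_nat (_ : 4 = 2 ^ 2)%N// expnAC leq_exp2r// ltnW// ltn_expl.
have d1 : (d%:R <= d%:R ^+ 2 :> R)%R.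
  by rewrite -natrX ler_nat; case: (d) => // k; rewrite leq_pmulr.
have K4 : (0 <= K ^+ 4)%R by rewrite exprn_ge0 ?(ltW K0).
have K'4 : (0 <= (K + s / Num.sqrt 2) ^+ 4)%R by rewrite exprn_ge0 ?(ltW K'0).
move: (K ^+ 4)%R ((K + _) ^+ 4)%R K4 K'4 => k k' k0 k'0.
move: (4 ^+ d)%R (d%:R : R) d2 d1 => u v d2 d1.
nra.
Unshelve. all: by end_near. Qed.

Theorem theorem3 (R : realType) (sigma K : R) (hsigma : (0 < sigma)%R)
    (hK : (0 < K)%R) :
  (forall d n : nat, (1 <= d)%N -> (1 <= n)%N ->
    ereal_sup
      [set \int[product_pow P n]_S
             `| differential_entropy (convolution P (gaussian d sigma))
                - differential_entropy
                    (convolution (empirical S) (gaussian d sigma)) |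
      | P in [set P : probability (rvec R d) R | subgaussian K P]]
    <= (entropy_const sigma d K / Num.sqrt n%:R)%:E) /\
  exists2 c : R, (0 < c)%R &
    (fun d : nat => entropy_const sigma d K) =O_\oo (fun d : nat => (c ^+ d)%R).
Proof.
split; last exact: entropy_const_bigO.
move=> d n d0 n0; apply: ge_ereal_sup => _ [P sgP <-].
exact: expected_entropy_dist_le.
Qed.
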